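(* Let $n$ be a positive integer, let $F$ be a field with $\operatorname{char} F\neq 2$, let $\lambda$ be a partition of $n$, and let $S^\lambda$ be the Specht module over $F\Sigma_n$ corresponding to $\lambda$. (a) Let $b$ be a block idempotent of $F\Sigma_{n-1}$. Then the $F\Sigma_{n-1}$-module $(S^\lambda\downarrow_{\Sigma_{n-1}})\,b$ is $0$ or indecomposable. (b) Let $B$ be a block idempotent of $F\Sigma_{n+1}$. Then the $F\Sigma_{n+1}$-module $(S^\lambda\uparrow^{\Sigma_{n+1}})\,B$ is $0$ or indecomposable.
   Context: $\Sigma_k$ is the symmetric group on $\{1,\ldots,k\}$, and $\Sigma_{n-1}\subset\Sigma_n\subset\Sigma_{n+1}$ in the usual way. Modules are right modules. $\downarrow_{\Sigma_{n-1}}$ denotes restriction and $\uparrow^{\Sigma_{n+1}}$ denotes induction. A block idempotent of a group algebra $FG$ is a primitive idempotent of its center $Z(FG)$. The Specht module $S^\lambda$ follows the conventions of James: a $\lambda$-tableau is a bijection $t$ from the Young diagram $[\lambda]$ (rows numbered top to bottom, columns left to right) to $\{1,\ldots,n\}$, with $\pi\in\Sigma_n$ acting by $(t\pi)_{rc}=(t_{rc})\pi$ (permutations act on the right); the $\lambda$-tabloid $\{t\}$ is the ordered set partition of $\{1,\ldots,n\}$ whose $u$-th part is the set of entries in the $u$-th row of $t$; $M^\lambda$ is the $F$-vector space with basis the $\lambda$-tabloids and action $\{t\}\pi=\{t\pi\}$; $C_t$ is the column stabilizer of $t$; the polytabloid is $e_t=\sum_{\pi\in C_t}\operatorname{sgn}(\pi)\{t\pi\}$;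 and $S^\lambda$ is the $F\Sigma_n$-submodule of $M^\lambda$ spanned by all polytabloids $e_t$. *)

(* Defs.v *)
From mathcomp Require Import all_boot all_order all_algebra.
From mathcomp Require Import all_fingroup all_solvable all_field all_character.

Set Implicit Arguments.
Unset Strict Implicit.
Unset Printing Implicit Defensive.

Import GroupScope GRing.Theory.
Local Open Scope ring_scope.

(* Permutations act on the right: [s * t] is "first s, then t", and matrix
   representations act on row vectors by right multiplication, so that
   mx_representation F G d is a right FG-module structure on 'rV[F]_d.
   The letters are 'I_n = {0, ..., n-1} in place of {1, ..., n}. *)

Section Modules.

Variables (F : fieldType) (gT : finGroupType) (G : {group gT}).

Definition mxindecomposable d (rG : mx_representation F G d) (U : 'M[F]_d) :=
  [/\ mxmodule rG U, U != 0
    & forall A B : 'M[F]_d, mxmodule rG A -> mxmodule rG B ->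
      (A + B :=: U)%MS -> (A :&: B)%MS = 0 -> A = 0 \/ B = 0].

Definition central_idempotent (e : 'M[F]_#|G|) :=
  (e \in 'Z(group_ring F G))%MS /\ e *m e = e.

Definition block_idempotent (e : 'M[F]_#|G|) :=
  [/\ central_idempotent e, e != 0
    & forall e1 e2, central_idempotent e1 -> central_idempotent e2 ->
      e1 *m e2 = 0 -> e2 *m e1 = 0 -> e = e1 + e2 -> e1 = 0 \/ e2 = 0].

(* The row space of this matrix is the submodule V e = {v e | v in V}. *)
Definition mod_mul d (rG : mx_representation F G d) (e : 'M[F]_#|G|) :
  'M[F]_d := gring_op rG e.

End Modules.

Section Restriction.

Variables (F : fieldType) (aT rT : finGroupType).
Variables (f : {morphism [set: aT] >-> rT}).
Variables (d : nat) (rG : mx_representation F [set: rT] d).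

Definition restr_repr : mx_representation F [set: aT] d :=
  morphim_repr (subg_repr rG (subsetT (f @* [set: aT]))) (subxx _).

Lemma restr_reprE x : restr_repr x = rG (f x).
Proof. by []. Qed.

End Restriction.

(* V (x)_{FH} FG for a right FH-module V, where FG is a left FH-module through
   f : H -> G; it is the quotient of V (x)_F FG, encoded by mxvec on
   d x #|G| matrices, by the span of the v h (x) g - v (x) f(h) g. *)
Section Induction.

Variables (F : fieldType) (aT rT : finGroupType).
Variables (f : {morphism [set: aT] >-> rT}).
Variables (d : nat) (rH : mx_representation F [set: aT] d).

Local Notation G := [set: rT]%G.

Definition gbasis (g : rT) : 'rV[F]_#|G| := delta_mx 0 (gring_index G g).

Definition tens (v : 'rV[F]_d) (a : 'rV[F]_#|G|) : 'rV[F]_(d * #|G|) :=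
  mxvec (v^T *m a).

Definition tens_mx (g : rT) : 'M[F]_(d * #|G|) :=
  lin_mulmxr (regular_repr F G g).

Lemma tens_mxE v a g : tens v a *m tens_mx g = tens v (a *m regular_repr F G g).
Proof. by rewrite /tens mul_vec_lin /= mulmxA. Qed.

Lemma tens_mx_repr : mx_repr G tens_mx.
Proof.
split=> [|x y Gx Gy].
  apply/row_matrixP=> i; rewrite !rowE mulmx1.
  rewrite -[delta_mx 0 i]vec_mxK /tens_mx mul_vec_lin /=.
  by rewrite repr_mx1 mulmx1.
apply/row_matrixP=> i; rewrite !rowE -[delta_mx 0 i]vec_mxK.
by rewrite mulmxA /tens_mx !mul_vec_lin /= repr_mxM // mulmxA.
Qed.
Canonical tens_repr := MxRepresentation tens_mx_repr.

Definition balance (i : 'I_d) (h : aT) (g : rT) : 'rV[F]_(d * #|G|) :=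
  tens (delta_mx 0 i *m rH h) (gbasis g)
  - tens (delta_mx 0 i) (gbasis (f h * g)%g).

Definition balance_mx : 'M[F]_(d * #|G|) :=
  (\sum_i \sum_(h : aT) \sum_(g : rT) <<balance i h g>>)%MS.

Lemma gbasisM g x : gbasis g *m regular_repr F G x = gbasis (g * x)%g.
Proof. by rewrite -rowE rowK gring_indexK ?inE. Qed.

Lemma balance_mxmodule : mxmodule tens_repr balance_mx.
Proof.
apply/mxmoduleP=> x Gx; rewrite /balance_mx sumsmxMr_gen.
apply/sumsmx_subP=> i _; rewrite genmxE sumsmxMr_gen.
apply/sumsmx_subP=> h _; rewrite genmxE sumsmxMr_gen.
apply/sumsmx_subP=> g _; rewrite genmxE (eqmxMr _ (genmxE _)).
rewrite mulmxBl !tens_mxE !gbasisM -mulgA.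
apply: (sumsmx_sup i) => //; apply: (sumsmx_sup h) => //.
by apply: (sumsmx_sup (g * x)%g); rewrite // genmxE.
Qed.

Definition ind_repr : mx_representation F G (\rank (cokermx balance_mx)) :=
  factmod_repr balance_mxmodule.

End Induction.

Section SymIncl.

Variable n : nat.

Definition sym_incl_fun (s : 'S_n) : 'S_n.+1 := lift_perm ord_max ord_max s.

Lemma sym_incl_morphM :
  {in [set: 'S_n] &, {morph sym_incl_fun : x y / (x * y)%g}}.
Proof. by move=> x y _ _; rewrite /sym_incl_fun lift_permM. Qed.

Canonical sym_incl : {morphism [set: 'S_n] >-> 'S_n.+1} :=
  Morphism sym_incl_morphM.

End SymIncl.

Definition is_partition (n : nat) (la : seq nat) : bool :=
  [&& sorted geq la, all (leq 1) la & sumn la == n].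

Section Specht.

Variables (F : fieldType) (n : nat) (la : seq nat).

Definition node := {r : 'I_(size la) & 'I_(nth 0%N la r)}.
Definition node_row (x : node) : 'I_(size la) := tag x.
Definition node_col (x : node) : nat := tagged x.

Definition tableau :=
  {t : {ffun node -> 'I_n} | injectiveb t && [forall i, i \in codom t]}.

Definition tab_act_fun (t : tableau) (p : 'S_n) : {ffun node -> 'I_n} :=
  [ffun x => p (val t x)].

Lemma tab_act_subproof t p :
  injectiveb (tab_act_fun t p) && [forall i, i \in codom (tab_act_fun t p)].
Proof.
have /andP[/injectiveP injt /forallP surjt] := valP t; apply/andP; split.
  by apply/injectiveP=> x y; rewrite !ffunE => /perm_inj /injt.
apply/forallP=> i; have /codomP[x def_x] := surjt ((p^-1)%g i).
by apply/codomP; exists x; rewrite ffunE -def_x permKV.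
Qed.

Definition tab_act (t : tableau) (p : 'S_n) : tableau :=
  Sub (tab_act_fun t p) (tab_act_subproof t p).

Definition row_parts (t : tableau) : {ffun 'I_(size la) -> {set 'I_n}} :=
  [ffun u => [set val t x | x : node & node_row x == u]].

Definition tabloid :=
  {T : {ffun 'I_(size la) -> {set 'I_n}} | [exists t, T == row_parts t]}.

Lemma tabloid_of_subproof t : [exists t', row_parts t == row_parts t'].
Proof. by apply/existsP; exists t. Qed.

Definition tabloid_of (t : tableau) : tabloid :=
  Sub (row_parts t) (tabloid_of_subproof t).

Lemma row_parts_act t p :
  row_parts (tab_act t p) = [ffun u => [set p i | i in row_parts t u]].
Proof.
apply/ffunP=> u; rewrite !ffunE -imset_comp.
by apply: eq_imset => x; rewrite /= ffunE.
Qed.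

Lemma tabloid_act_subproof (T : tabloid) (p : 'S_n) :
  [exists t, [ffun u => [set p i | i in val T u]] == row_parts t].
Proof.
have /existsP[t /eqP->] := valP T.
by apply/existsP; exists (tab_act t p); rewrite row_parts_act.
Qed.

Definition tabloid_act (T : tabloid) (p : 'S_n) : tabloid :=
  Sub [ffun u => [set p i | i in val T u]] (tabloid_act_subproof T p).

Lemma tabloid_actE t p : tabloid_act (tabloid_of t) p = tabloid_of (tab_act t p).
Proof. by apply: val_inj; rewrite /= row_parts_act. Qed.

Definition tabloid_vec (T : tabloid) : 'rV[F]_#|{: tabloid}| :=
  delta_mx 0 (enum_rank T).

Definition tabloid_mx (p : 'S_n) : 'M[F]_#|{: tabloid}| :=
  \matrix_i tabloid_vec (tabloid_act (enum_val i) p).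

Lemma tabloid_vec_act T p :
  tabloid_vec T *m tabloid_mx p = tabloid_vec (tabloid_act T p).
Proof. by rewrite -rowE rowK enum_rankK. Qed.

Lemma tabloid_mx_repr : mx_repr [set: 'S_n] tabloid_mx.
Proof.
split=> [|p q _ _]; apply/row_matrixP=> i; rewrite rowK.
  rewrite row1 -[in RHS](enum_valK i); congr (tabloid_vec _).
  apply: val_inj; apply/ffunP=> u; rewrite /= ffunE -[RHS]imset_id.
  by apply: eq_imset => x; rewrite perm1.
rewrite row_mul rowK tabloid_vec_act; congr (tabloid_vec _).
apply: val_inj; apply/ffunP=> u; rewrite /= !ffunE -imset_comp.
by apply: eq_imset => x; rewrite permM.
Qed.

(* The permutation module M^lambda. *)
Canonical tabloid_repr := MxRepresentation tabloid_mx_repr.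

Definition tab_col (t : tableau) (c : nat) : {set 'I_n} :=
  [set val t x | x : node & node_col x == c].

Definition col_stab (t : tableau) : {set 'S_n} :=
  [set p : 'S_n |
    [forall x : node, [set p i | i in tab_col t (node_col x)]
                      == tab_col t (node_col x)]].

Definition polytabloid (t : tableau) : 'rV[F]_#|{: tabloid}| :=
  \sum_(p in col_stab t) (-1) ^+ p *: tabloid_vec (tabloid_of (tab_act t p)).

Definition specht_mx : 'M[F]_#|{: tabloid}| :=
  (\sum_(t : tableau) <<polytabloid t>>)%MS.

Lemma tab_act_col t p c :
  tab_col (tab_act t p) c = [set p i | i in tab_col t c].
Proof.
rewrite /tab_col -imset_comp.
by apply: eq_imset => x; rewrite /= ffunE.
Qed.

Lemma tab_actM t p q : tab_act t (p * q)%g = tab_act (tab_act t p) q.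
Proof. by apply: val_inj; apply/ffunP=> x; rewrite /= !ffunE permM. Qed.

Lemma col_stabJ t p q : ((q ^ p)%g \in col_stab (tab_act t p)) = (q \in col_stab t).
Proof.
rewrite !inE; apply: eq_forallb => x; rewrite tab_act_col.
move: (tab_col t _) => A.
have -> : [set (q ^ p)%g i | i in [set p i | i in A]]
        = [set p i | i in [set q i | i in A]].
  by rewrite -!imset_comp; apply: eq_imset => i; rewrite /= permJ.
by rewrite (inj_eq (imset_inj (@perm_inj _ p))).
Qed.

Lemma polytabloid_act t p :
  polytabloid t *m tabloid_mx p = polytabloid (tab_act t p).
Proof.
rewrite /polytabloid mulmx_suml [RHS](reindex_inj (conjg_inj p)) /=.
apply: eq_big => [q|q _]; first by rewrite col_stabJ.
rewrite -scalemxAl tabloid_vec_act tabloid_actE -!tab_actM odd_permJ.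
by rewrite conjgE mulKVg.
Qed.

Lemma specht_mxmodule : mxmodule tabloid_repr specht_mx.
Proof.
apply/mxmoduleP=> p _; rewrite /specht_mx sumsmxMr_gen.
apply/sumsmx_subP=> t _; rewrite genmxE (eqmxMr _ (genmxE _)).
by apply: (sumsmx_sup (tab_act t p)); rewrite //= polytabloid_act genmxE.
Qed.

Definition specht_repr : mx_representation F [set: 'S_n] (\rank specht_mx) :=
  submod_repr specht_mxmodule.

End Specht.

(* Main.v *)
Require Import Defs.
From mathcomp Require Import all_boot all_order all_algebra.
From mathcomp Require Import all_fingroup all_solvable all_field all_character.
From mathcomp Require Import ring.

(* Let L_n be the sum of the transpositions (j n) with j < n.  In
   characteristic other than 2, the endomorphism ring of S^lambda restricted
   to Sigma_{n-1} is F[L_n].  Since L_n is the difference between the sum of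
   all transpositions of Sigma_n, which acts on S^lambda as a scalar, and that
   of Sigma_{n-1}, every endomorphism of the restriction is the action of a
   central element of F Sigma_{n-1}; as the centre of a block contains only
   trivial idempotents, the block components are indecomposable.
     For the induced module, Mackey's formula identifies an endomorphism with a
   pair (s, theta) with s in End(S^lambda) = F and theta in F[L_n], and
   multiplication by L_{n+1} turns (s, theta) into (s', s + theta L_n).  Hence
   the endomorphism ring is F[L_{n+1}], and it comes again from the centre.
     The equality with F[L_n] is proved by removing the first column A of the
   diagram.  Let t be a tableau with n at the bottom of A.  An endomorphism of
   the restriction has, for each letter k, a conjugate commuting with the
   stabiliser of k; let x_k be the image of the polytabloid e_t under it.  For k
   outside A, the x_k amount to such a family for the diagram without A.  If a
   later column is as long as A, then that family determines x.  Otherwise x is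
   determined by a scalar s and another family theta for the smaller diagram,
   and L_n + |A| - 1 maps (s, theta) to (0, s + theta (L + |A|)), where L is the
   Jucys-Murphy element of the smaller diagram; hence induction applies. *)

Set Implicit Arguments.
Unset Strict Implicit.
Unset Printing Implicit Defensive.

Import GRing.Theory.
Local Open Scope ring_scope.

(** * Words and families *)

Section Words.

Variable T : finType.
Implicit Types (w : T -> nat) (a b : T).

(* A word gives the row of each letter.  On functions of words, composition with
   [swap_word a b] is the right action of the transposition (a b). *)
Definition swap_word a b w : T -> nat := fun z => w (tperm a b z).
Definition set_letter w a r : T -> nat := fun z => if z == a then r else w z.

Lemma swap_wordJ a b p q w :
  swap_word (tperm a b p) (tperm a b q) (swap_word a b w)
  =1 swap_word a b (swap_word p q w).
Proof.
move=> z; rewrite /swap_word; congr (w _).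
rewrite -[in LHS](tpermK a b z); move: (tperm a b z) => y.
case: (tpermP p q y) => [->|->|/eqP yp /eqP yq].
- by rewrite tpermL tpermK.
- by rewrite tpermR tpermK.
- by rewrite [X in tperm a b X]tpermD ?tpermK // (inj_eq perm_inj) eq_sym.
Qed.

Lemma swap_set_letter a b w z r :
  swap_word a b (set_letter w z r)
  =1 set_letter (swap_word a b w) (tperm a b z) r.
Proof.
by move=> y; rewrite /swap_word /set_letter (can2_eq (@tpermK _ a b) (@tpermK _ a b)).
Qed.

End Words.

(** * Families of functions on words and the Jucys-Murphy operator *)

Section Families.

Variables (F : fieldType) (T : finType) (R C : T -> nat).
Hypothesis two_neq0 : 2%:R != 0 :> F.
Hypothesis pos_inj : forall a b, R a = R b -> C a = C b -> a = b.
Hypothesis pos_up :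
  forall a r, (r < R a)%N -> exists2 b, C b = C a & R b = r.
Hypothesis pos_left :
  forall a c, (c < C a)%N -> exists2 b, C b = c & R b = R a.

Implicit Types (w u : T -> nat) (x y : T -> (T -> nat) -> F).

Definition local c (v : (T -> nat) -> F) :=
  forall w u, (forall z, (c <= C z)%N -> w z = u z) -> v w = v u.

Definition content c w := forall r : nat,
  #|[pred z | (c <= C z)%N && (w z == r)]|
  = #|[pred z | (c <= C z)%N && (R z == r)]|.

(* R and C are the rows and columns of the letters in a tableau t, of which only
   the columns from c on are used.  x k is the image of the polytabloid e_t under
   an endomorphism that commutes with the stabiliser of k.  fam_ker: x k is
   annihilated by the maps that move one letter from row r up to row s, as is the
   whole Specht module.  fam_alt and fam_garnir come from the relations
   e_t (a b) = - e_t and e_t = sum_a e_t (a b). *)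
Record family c x : Prop := Family {
  fam_local : forall k, (c <= C k)%N -> local c (x k);
  fam_content : forall k w, (c <= C k)%N -> x k w != 0 -> content c w;
  fam_ker : forall k w (r s : nat), (c <= C k)%N -> (s < r)%N ->
    \sum_(z | (c <= C z)%N && (w z == s)) x k (set_letter w z r) = 0;
  fam_alt : forall k a b w, (c <= C k)%N -> (c <= C a)%N -> C a = C b ->
    a != b -> x (tperm a b k) (swap_word a b w) = - x k w;
  fam_garnir : forall k b d w, (c <= C k)%N -> (c <= d)%N -> (d < C b)%N ->
    x k w = \sum_(a | C a == d) x (tperm a b k) (swap_word a b w) }.

(* Composition of the endomorphisms with the Jucys-Murphy element. *)
Definition jm c x : T -> (T -> nat) -> F := fun k w =>
  \sum_(j | (c <= C j)%N && (j != k)) x j (swap_word j k w).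


Lemma C_tperm c a b z : (c <= C a)%N -> (c <= C b)%N ->
  (c <= C (tperm a b z))%N = (c <= C z)%N.
Proof. by move=> ca cb; case: tpermP => [->|->|]; rewrite ?ca ?cb. Qed.

Lemma card_swap c a b w (r : nat) : (c <= C a)%N -> (c <= C b)%N ->
  #|[pred z | (c <= C z)%N && (swap_word a b w z == r)]|
  = #|[pred z | (c <= C z)%N && (w z == r)]|.
Proof.
move=> ca cb; rewrite -!sum1_card (reindex_inj (@perm_inj _ (tperm a b))) /=.
by apply: eq_bigl => z; rewrite !inE /swap_word tpermK C_tperm.
Qed.

Lemma content_swap c a b w : (c <= C a)%N -> (c <= C b)%N ->
  content c (swap_word a b w) <-> content c w.
Proof.
by move=> ca cb; split=> H r; [rewrite -(card_swap w r ca cb)|rewrite card_swap].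
Qed.

Lemma swap_agree c a b w u : (c <= C a)%N -> (c <= C b)%N ->
  (forall z, (c <= C z)%N -> w z = u z) ->
  forall z, (c <= C z)%N -> swap_word a b w z = swap_word a b u z.
Proof. by move=> ca cb wu z cz; apply: wu; rewrite C_tperm. Qed.

Lemma content_row c w z : content c w -> (c <= C z)%N ->
  exists2 y, (c <= C y)%N & R y = w z.
Proof.
move=> cw cz; have : (0 < #|[pred y | (c <= C y)%N && (R y == w z)]|)%N.
  by rewrite -cw; apply/card_gt0P; exists z; rewrite inE cz eqxx.
by case/card_gt0P=> y; rewrite inE => /andP[cy /eqP]; exists y.
Qed.

Lemma family_ext c x y : (forall k w, (c <= C k)%N -> x k w = y k w) ->
  family c x -> family c y.
Proof.
move=> xy [Hl Hc Hk Ha Hg]; split.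
- by move=> k ck w u wu; rewrite -!xy //; apply: Hl.
- by move=> k w ck; rewrite -xy //; apply: Hc.
- by move=> k w r s ck sr; rewrite -[RHS](Hk k w r s ck sr); apply: eq_bigr => z _; rewrite xy.
- by move=> k a b w ck ca cab ab; rewrite -!xy ?Ha // C_tperm // -cab.
- move=> k b d w ck cd db; rewrite -xy // (Hg k b d) //.
  apply: eq_bigr => a /eqP Ca; rewrite xy // C_tperm ?Ca //.
  exact: leq_trans cd (ltnW db).
Qed.

Lemma family0 c : family c (fun _ _ => 0).
Proof.
split=> //.
- by move=> k w _; rewrite eqxx.
- by move=> k w r s _ _; rewrite big1.
- by move=> *; rewrite oppr0.
- by move=> *; rewrite big1.
Qed.

Lemma familyD c (l m : F) x y : family c x -> family c y ->
  family c (fun k w => l * x k w + m * y k w).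
Proof.
move=> [Hl Hc Hk Ha Hg] [Hl' Hc' Hk' Ha' Hg']; split.
- by move=> k ck w u wu; rewrite (Hl k ck w u) // (Hl' k ck w u).
- move=> k w ck; have [/eqP x0|/Hc H _] := boolP (x k w == 0); last exact: H.
  have [/eqP y0|/Hc' H _] := boolP (y k w == 0); last exact: H.
  by rewrite x0 y0 !mulr0 addr0 eqxx.
- by move=> k w r s ck sr; rewrite big_split -!mulr_sumr /= Hk // Hk' // !mulr0 addr0.
- by move=> k a b w ck ca cab ab; rewrite Ha // Ha' // !mulrN opprD.
- move=> k b d w ck cd db; rewrite (Hg k b d) // (Hg' k b d) //.
  by rewrite !mulr_sumr -big_split.
Qed.

Lemma jm_swap c x k a b w : (c <= C a)%N -> (c <= C b)%N -> (c <= C k)%N ->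
  (forall j, (c <= C j)%N -> local c (x j)) ->
  jm c x (tperm a b k) (swap_word a b w)
  = \sum_(j | (c <= C j)%N && (j != k))
      x (tperm a b j) (swap_word a b (swap_word j k w)).
Proof.
move=> ca cb ck xl; rewrite /jm (reindex_inj (@perm_inj _ (tperm a b))) /=.
apply: eq_big => [j|j]; first by rewrite C_tperm // (inj_eq perm_inj).
rewrite C_tperm // => /andP[cj jk]; apply: xl => [|z cz].
  by rewrite C_tperm.
by rewrite swap_wordJ.
Qed.

(** The kernel, alternating and Garnir relations hold for each [j] of the sum separately;
    conjugation by (a b) merely permutes the summands ([jm_swap]). *)
Lemma family_jm c x : family c x -> family c (jm c x).
Proof.
move=> [Hl Hc Hk Ha Hg]; split.
- move=> k ck w u wu; apply: eq_bigr => j /andP[cj _].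
  by apply: Hl => // z cz; apply: swap_agree cz.
- move=> k w ck; rewrite /jm => nz.
  have /existsP[j /andP[/andP[cj jk] xj]] :
      [exists j, ((c <= C j)%N && (j != k)) && (x j (swap_word j k w) != 0)].
    apply: contraNT nz; rewrite negb_exists => /forallP H.
    rewrite big1 // => j jP; apply/eqP.
    by have := H j; rewrite jP /= negbK.
  by have /content_swap := Hc j _ cj xj; apply.
- move=> k w r s ck sr; rewrite exchange_big /= big1 // => j /andP[cj jk].
  rewrite -[RHS](Hk j (swap_word j k w) r s cj sr).
  rewrite [RHS](reindex_inj (@perm_inj _ (tperm j k))) /=.
  apply: eq_big => [z|z _]; first by rewrite C_tperm // /swap_word tpermK.
  by apply: Hl => // y cy; rewrite swap_set_letter.
- move=> k a b w ck ca cab ab; have cb : (c <= C b)%N by rewrite -cab.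
  rewrite jm_swap // -sumrN; apply: eq_bigr => j /andP[cj jk].
  by rewrite Ha.
- move=> k b d w ck cd db; have cb := leq_trans cd (ltnW db).
  transitivity (\sum_(j | (c <= C j)%N && (j != k)) \sum_(a | C a == d)
      x (tperm a b j) (swap_word a b (swap_word j k w))).
    by apply: eq_bigr => j /andP[cj jk]; apply: Hg.
  rewrite exchange_big /=; apply: eq_bigr => a /eqP Ca.
  by rewrite jm_swap // Ca.
Qed.

(** If two letters of [P] had the same row, swapping them would fix the word but change the sign of
    its value; as 2 is invertible, the value would be 0. *)
Lemma alt_inj c (P : pred T) v w : local c v ->
  (forall a b u, P a -> P b -> a != b -> v (swap_word a b u) = - v u) ->
  v w != 0 -> {in P &, injective w}.
Proof.
move=> vl va nz a b Pa Pb wab; apply/eqP; apply: contraR nz => ab.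
have: v (swap_word a b w) = v w.
  by apply: vl => z _; rewrite /swap_word; case: tpermP => [->|->|].
rewrite va // => /eqP; rewrite eq_sym -addr_eq0 -mulr2n -mulr_natl mulf_eq0.
by rewrite (negPf two_neq0).
Qed.

(** Pigeonhole: [w] takes as many values on [P] as [P] has letters, and all of them are rows of
    [P]. *)
Lemma rows_onto (P : pred T) w : {in P &, injective w} ->
  (forall a, P a -> exists2 b, P b & R b = w a) ->
  forall a, P a -> exists2 b, P b & w b = R a.
Proof.
move=> wI wR a Pa.
have sub : {subset map w (enum P) <= map R (enum P)}.
  move=> r /mapP[b]; rewrite mem_enum => /wR[b' Pb' <-] ->.
  by apply: map_f; rewrite mem_enum.
have un : uniq (map w (enum P)).
  by rewrite map_inj_in_uniq ?enum_uniq // => b b'; rewrite !mem_enum; apply: wI.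
have [|_ E] := uniq_min_size un sub; first by rewrite !size_map.
have : R a \in map R (enum P) by apply: map_f; rewrite mem_enum.
by rewrite -E => /mapP[b]; rewrite mem_enum => Pb ->; exists b.
Qed.

Definition fill (P : pred T) w : T -> nat := fun z => if P z then R z else w z.

(** Sorting: if a letter [a] of [P] is misplaced, swapping it with the letter [b] whose own row is
    [u a] changes only the sign of [v] and lowers the number of misplaced letters. So a nonzero
    value survives until [P] is sorted. *)
Lemma alt_sort c (P : pred T) v w : local c v ->
  (forall a b u, P a -> P b -> a != b -> v (swap_word a b u) = - v u) ->
  (forall u a, {in predC P, u =1 w} -> v u != 0 -> P a ->
     exists2 b, P b & R b = u a) ->
  v (fill P w) = 0 -> v w = 0.
Proof.
move=> vl va vR v0; apply/eqP/negPn/negP => nz.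
suff H u : {in predC P, u =1 w} -> v u != 0 -> v (fill P w) != 0.
  by move: (H w) => /(_ (fun _ _ => erefl) nz) /negP; rewrite v0 eqxx.
have [m] := ubnP #|[pred a | P a && (u a != R a)]|.
elim: m u => // m IH u mism uw nzu.
have uI := alt_inj vl va nzu.
have [a|/= all_ok] := pickP [pred a | P a && (u a != R a)]; last first.
  rewrite (vl _ u) // => z _; rewrite /fill; case: ifP => [|/negbT] Pz.
    by have /negbT/= := all_ok z; rewrite Pz /= negbK => /eqP.
  by rewrite uw.
rewrite inE => /andP[Pa ua]; have [b Pb Rb] := vR _ _ uw nzu Pa.
have ab : a != b by apply: contraNneq ua => ab; rewrite -Rb ab.
apply: (IH (swap_word a b u)); last by rewrite va // oppr_eq0.
  rewrite -ltnS; apply: leq_trans mism; rewrite ltnS; apply: proper_card.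
  apply/properP; split.
    apply/subsetP=> z; rewrite !inE /swap_word => /andP[Pz].
    case: tpermP => [-> _|->|_ _]; rewrite ?Pz ?Pa //.
    by rewrite Rb eqxx.
  (* Before the swap [b] was misplaced as well, by injectivity of [u] on [P]. *)
  exists b; rewrite !inE Pb /= /swap_word ?tpermR ?Rb ?eqxx //.
  by apply: contraNneq ab => ub; apply/eqP/uI => //; rewrite ub.
move=> z Pz; rewrite -uw // /swap_word tpermD //.
  by apply: contraNneq Pz => <-.
by apply: contraNneq Pz => <-.
Qed.

Lemma card_column c w (r : nat) :
  #|[pred z | (c <= C z)%N && (w z == r)]|
  = (#|[pred z | (C z == c) && (w z == r)]|
     + #|[pred z | (c < C z)%N && (w z == r)]|)%N.
Proof.
rewrite -!sum1_card (bigID [pred z | C z == c]) /=; congr (_ + _)%N; apply: eq_bigl.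
  by move=> z; rewrite !inE; case: ltngtP => //=; rewrite ?andbT ?andbF.
by move=> z; rewrite !inE; case: ltngtP => //=; rewrite ?andbT ?andbF.
Qed.

(** * Removal of column [c] *)

Section Column.

Variable c : nat.
Local Notation col := [pred z | C z == c].

Lemma content_fill w : content c (fill col w) -> content c.+1 w.
Proof.
move=> H r; have := H r; rewrite (card_column c (fill col w)) (card_column c R).
have -> : #|[pred z | (C z == c) && (fill col w z == r)]|
  = #|[pred z | (C z == c) && (R z == r)]|.
  by apply: eq_card => z; rewrite !inE /fill /=; case: (C z == c).
move/addnI => <-; apply: eq_card => z; rewrite !inE /fill /=.
by case: ltngtP.
Qed.

Lemma fill_agree w u : (forall z, (c < C z)%N -> w z = u z) ->
  forall z, (c <= C z)%N -> fill col w z = fill col u z.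
Proof. by move=> wu z; rewrite /fill /=; case: ltngtP => // cz _; apply: wu. Qed.

Lemma swap_fill a b w : (c < C a)%N -> (c < C b)%N ->
  fill col (swap_word a b w) =1 swap_word a b (fill col w).
Proof.
move=> ca cb z; rewrite /fill /swap_word /=.
by case: tpermP => [->|->|]; rewrite ?(gtn_eqF ca) ?(gtn_eqF cb).
Qed.

Lemma set_fill a r w : (c < C a)%N ->
  fill col (set_letter w a r) =1 set_letter (fill col w) a r.
Proof.
by move=> ca z; rewrite /fill /set_letter /=; case: (z =P a) => // ->; rewrite (gtn_eqF ca).
Qed.

(* If k lies to the right of column c then x k alternates on that column, so
   erase x k determines x k. *)
Definition erase x : T -> (T -> nat) -> F := fun k w => x k (fill col w).

Lemma col_R_inj : {in col &, injective R}.
Proof. by move=> a b /eqP ca /eqP cb /pos_inj; apply; rewrite cb. Qed.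

(** The diagram is left-justified, so column [c] meets every row that the later columns meet. *)
Lemma col_row w z : content c w -> (c <= C z)%N -> exists2 b, col b & R b = w z.
Proof.
move=> cw cz; have [y cy <-] := content_row cw cz.
move: cy; rewrite leq_eqVlt => /orP[/eqP cy|/pos_left[b cb <-]].
  by exists y => //=; rewrite cy.
by exists b => //=; rewrite cb.
Qed.

Lemma big_column (G : T -> F) (Q : pred T) :
  \sum_(z | (c <= C z)%N && Q z) G z
  = \sum_(z | (C z == c) && Q z) G z + \sum_(z | (c < C z)%N && Q z) G z.
Proof.
rewrite (bigID [pred z | C z == c]) /=; congr (_ + _); apply: eq_bigl.
  by move=> z; rewrite /=; case: ltngtP => //=; rewrite ?andbT ?andbF.
by move=> z; rewrite /=; case: ltngtP => //=; rewrite ?andbT ?andbF.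
Qed.

Lemma column_alt x k : family c x -> (c < C k)%N ->
  forall a b u, col a -> col b -> a != b -> x k (swap_word a b u) = - x k u.
Proof.
move=> [_ _ _ Ha _] ck a b u /eqP ca /eqP cb ab.
rewrite -(Ha k a b) ?ca ?cb // ?(ltnW ck) // tpermD //.
  by apply: contraTneq ck => <-; rewrite ca ltnn.
by apply: contraTneq ck => <-; rewrite cb ltnn.
Qed.

Lemma family_erase x : family c x -> family c.+1 (erase x).
Proof.
move=> xF; have [Hl Hc Hk Ha Hg] := xF; split.
- by move=> k ck w u wu; apply: Hl (ltnW ck) _ _ _ => z cz; apply: fill_agree cz.
- by move=> k w ck nz; apply: content_fill; apply: Hc nz; apply: ltnW.
- move=> k w r s ck sr.
  have := Hk k (fill col w) r s (ltnW ck) sr.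
  (* A term with [z] in column [c] vanishes: row [r] already holds another letter of that column, on
     which [x k] alternates. *)
  rewrite big_column [X in X + _]big1 ?add0r => [E|z /andP[/eqP cz]]; last first.
    rewrite /fill /= cz eqxx => /eqP Rz; apply/eqP/negPn/negP => nz.
    have xl := Hl k (ltnW ck); have wI := alt_inj xl (column_alt xF ck) nz.
    have [b cb Rb] := col_row (Hc _ _ (ltnW ck) nz) (eq_leq (esym cz)).
    move: Rb; rewrite /set_letter eqxx => Rb.
    have bz : b != z by apply: contraTneq sr => bz; rewrite -Rb -Rz bz ltnn.
    case/negP: bz; apply/eqP/wI; rewrite ?inE ?cz //= /set_letter eqxx.
    by case: eqP => // _; move: cb => /= ->.
  rewrite -[RHS]E; apply: eq_big => [z|z /andP[cz _]].
    by rewrite /fill /=; case: ltngtP.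
  by apply: Hl (ltnW ck) _ _ _ => y cy; rewrite -set_fill.
- move=> k a b w ck ca cab ab; rewrite /erase -(Ha k a b) ?(ltnW ck) ?(ltnW ca) //.
  apply: Hl => [|z _]; rewrite ?swap_fill -?cab //.
  by apply: ltnW; rewrite C_tperm // -cab.
- move=> k b d w ck cd db; rewrite /erase (Hg k b d) // ?(ltnW ck) ?(ltnW cd) //.
  apply: eq_bigr => a /eqP Ca; have ca : (c < C a)%N by rewrite Ca.
  have cb := ltn_trans cd db.
  apply: Hl => [|z _]; rewrite ?swap_fill //.
  by apply: ltnW; rewrite C_tperm.
Qed.

Lemma erase_inj x k : family c x -> (c < C k)%N ->
  (forall w, erase x k w = 0) -> forall w, x k w = 0.
Proof.
move=> xF ck x0 w; apply: (alt_sort (fam_local xF (ltnW ck)) (column_alt xF ck)) (x0 w).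
move=> u a _ /(fam_content xF (ltnW ck)) cu /eqP Ca.
by apply: col_row => //; rewrite Ca.
Qed.

(** The letters [j] right of column [c] give the smaller Jucys-Murphy sum; those in column [c] add
    up to [x k] by [fam_garnir] with [b = k]. *)
Lemma erase_jm x k w : family c x -> (c < C k)%N ->
  erase (jm c x) k w = jm c.+1 (erase x) k w + erase x k w.
Proof.
move=> xF ck; rewrite /erase {1}/jm big_column addrC; congr (_ + _).
  rewrite /jm; apply: eq_bigr => j /andP[cj _].
  by apply: (fam_local xF (ltnW cj)) => z _; rewrite swap_fill.
rewrite (fam_garnir xF _ (ltnW ck) (leqnn c) ck).
apply: eq_big => [j|j /andP[/eqP cj _]]; last by rewrite tpermR.
by case: eqP => //= cj; apply: contraTneq ck => <-; rewrite cj ltnn.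
Qed.

(** * The letter [n] at the bottom of column [c] *)

Section Bottom.

Variable n : T.
Hypothesis Cn : C n = c.
Hypothesis n_max : forall a, C a = c -> (R a <= R n)%N.
Local Notation col' := [pred z | (C z == c) && (z != n)].

Lemma cn : (c <= C n)%N. Proof. by rewrite Cn. Qed.

Lemma row_le w z : content c w -> (c <= C z)%N -> (w z <= R n)%N.
Proof. by move=> cw cz; have [b /eqP /n_max] := col_row cw cz; move=> + <-. Qed.

Lemma R_lt a : col' a -> (R a < R n)%N.
Proof.
case/andP=> /eqP Ca an; rewrite ltn_neqAle n_max // andbT.
by apply: contraNneq an => /pos_inj->; rewrite // Ca Cn.
Qed.

Lemma bottom_alt x : family c x ->
  forall a b u, col' a -> col' b -> a != b -> x n (swap_word a b u) = - x n u.
Proof.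
move=> xF a b u /andP[/eqP Ca an] /andP[/eqP Cb bn] ab.
by rewrite -(fam_alt xF _ cn _ _ ab) ?Ca ?Cb // tpermD.
Qed.

(** Pigeonhole: without [n] the column has fewer letters than rows. *)
Lemma missed_row w : exists2 a, C a = c & forall b, col' b -> w b != R a.
Proof.
pose s := map w (enum col').
have [/allP sub|] := boolP (all [in s] (map R (enum col))); last first.
  case/allPn=> _ /mapP[a + ->] Ra; rewrite mem_enum => /eqP Ca; exists a => // b cb.
  by apply: contra Ra => /eqP <-; apply: map_f; rewrite mem_enum.
have: uniq (map R (enum col)).
  rewrite map_inj_in_uniq ?enum_uniq // => a b; rewrite !mem_enum.
  exact: col_R_inj.
move/uniq_leq_size=> /(_ _ sub); rewrite !size_map -!cardE.
rewrite (cardD1 n) inE Cn eqxx add1n (eq_card (B := col')) ?ltnn //.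
by move=> z; rewrite !inE andbC.
Qed.

(** For [k] in column [c], the swap of [k] and [n] expresses [x k] by [x n] through [fam_alt]. *)
Lemma family_eq0 x : family c x ->
  (forall k w, (c < C k)%N -> x k w = 0) -> (forall w, x n w = 0) ->
  forall k w, (c <= C k)%N -> x k w = 0.
Proof.
move=> xF x0 xn0 k w; rewrite leq_eqVlt => /orP[/eqP Ck|]; last exact: x0.
have [->|kn] := eqVneq k n; first exact: xn0.
have ck : (c <= C k)%N by rewrite Ck.
have := fam_alt xF (swap_word k n w) cn ck _ kn.
rewrite tpermR xn0 oppr0 -Ck Cn => /(_ erefl) <-.
by apply: (fam_local xF ck) => z _; rewrite /swap_word tpermK.
Qed.

(** The column [D] of [z0] reaches row [R n], so a word in the support of [x n] puts exactly one
    letter of [D] in each row up to [R n]. A suitable Garnir relation then has only zero terms. *)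
Lemma bottom_eq0_long x : family c x ->
  (exists2 z, (c < C z)%N & R z = R n) ->
  (forall k w, (c < C k)%N -> x k w = 0) -> forall w, x n w = 0.
Proof.
move=> xF [z0 cz0 Rz0] x0 w; apply/eqP/negPn/negP => nz.
have xl := fam_local xF cn; have cw := fam_content xF cn nz.
pose d := C z0; pose D := [pred z | C z == d].
have alt_D a b u : D a -> D b -> a != b -> x n (swap_word a b u) = - x n u.
  move=> /eqP Ca /eqP Cb ab.
  rewrite -(fam_alt xF _ cn _ _ ab) ?Ca ?Cb ?(ltnW cz0) // tpermD //.
    by apply: contraTneq cz0 => an; rewrite -/d -Ca an Cn ltnn.
  by apply: contraTneq cz0 => bn; rewrite -/d -Cb bn Cn ltnn.
have D_row r : (r <= R n)%N -> exists2 b, D b & R b = r.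
  rewrite leq_eqVlt => /orP[/eqP->|]; first by exists z0; rewrite //= eqxx.
  by rewrite -Rz0 => /pos_up[b Cb Rb]; exists b; rewrite //= Cb.
have D_onto r : (r <= R n)%N -> exists2 b, D b & w b = r.
  move=> /D_row[b Db <-]; apply: (rows_onto (alt_inj xl alt_D nz)) Db => a Da.
  apply: D_row; apply: row_le => //; rewrite (eqP Da).
  exact: ltnW.
have [a0 Ca0 missed] := missed_row w.
(* [b] is the letter of [D] in a row that the rest of column [c] misses. *)
have [b Db wb] := D_onto _ (n_max Ca0).
have cb : (c < C b)%N by rewrite (eqP Db).
case/negP: nz; apply/eqP; rewrite (fam_garnir xF w cn (leqnn c) cb).
apply: big1 => a /eqP Ca; have [->|an] := eqVneq a n.
  by rewrite tpermL x0.
rewrite tpermD //; last by apply: contraTneq cb => ->; rewrite Cn ltnn.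
apply/eqP/negPn/negP => nz'.
have col_a : col' a by rewrite /= Ca eqxx.
(* After the swap [b] has the row [w a], which another letter [b'] of [D] occupies already. *)
have [b' Db' wb'] := D_onto _ (row_le cw (eq_leq (esym Ca))).
have bb' : b' != b.
  by apply: contraNneq (missed _ col_a) => b'b; rewrite -wb' b'b wb.
case: (negP bb'); apply/eqP/(alt_inj xl alt_D nz') => //.
rewrite /swap_word tpermR tpermD ?wb' // 1?eq_sym //.
by apply: contraTneq cb => ab'; rewrite (eqP Db) -(eqP Db') ab' Ca ltnn.
Qed.

(** * Column [c] longer than all later columns *)

Section Strict.

Hypothesis strict : forall z, (c < C z)%N -> (R z < R n)%N.

(** From column [c] on, [n] is the only letter of the tableau in row [R n], and [content] carries
    this count over to [w]. *)
Lemma bottom_unique w a z : content c w -> (c <= C a)%N -> (c <= C z)%N ->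
  w a = R n -> w z = R n -> a = z.
Proof.
move=> cw ca cz wa wz.
have /card_le1_eqP : (#|[pred t | (c <= C t)%N && (w t == R n)]| <= 1)%N.
  rewrite cw -(card1 n); apply/subset_leq_card/subsetP => t.
  rewrite !inE leq_eqVlt => /andP[/orP[/eqP Ct /eqP Rt|/strict]].
    by apply/eqP/pos_inj; rewrite // -Ct Cn.
  by rewrite ltn_neqAle => /andP[/negPf->].
by apply; rewrite inE ?ca ?cz ?wa ?wz ?eqxx.
Qed.

Lemma row_lt w a z : content c w -> (c <= C a)%N -> (c <= C z)%N ->
  w z = R n -> a != z -> (w a < R n)%N.
Proof.
move=> cw ca cz wz az; rewrite ltn_neqAle row_le // andbT.
by apply: contraNneq az => wa; apply/eqP/(bottom_unique cw).
Qed.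

(** For such [k] the function [x k] alternates on the whole of column [c], which forces one of its
    letters into row [R n] and leaves no room for [z]. *)
Lemma bottom_row_eq0 x k z u : family c x -> (c < C k)%N -> (c < C z)%N ->
  u z = R n -> x k u = 0.
Proof.
move=> xF ck cz uz; apply/eqP/negPn/negP => nz.
have cu := fam_content xF (ltnW ck) nz.
have coln : col n by rewrite /= Cn.
have [a /eqP Ca|b /eqP Cb ub] := rows_onto
  (alt_inj (fam_local xF (ltnW ck)) (column_alt xF ck) nz) _ coln.
  by apply: col_row; rewrite ?Ca.
have cb : (c <= C b)%N by rewrite Cb.
by have := bottom_unique cu cb (ltnW cz) ub uz => bz; rewrite -bz Cb ltnn in cz.
Qed.

(* The part of x n in which z is the only letter in the last row R n. *)
Definition theta x : T -> (T -> nat) -> F :=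
  fun z w => x n (swap_word z n (fill col w)).

Lemma theta_word_in z w a : (c < C z)%N -> col' a ->
  swap_word z n (fill col w) a = R a.
Proof.
move=> cz /andP[Ca an]; rewrite /swap_word tpermD ?[n == _]eq_sym //.
  by rewrite /fill /= Ca.
by apply: contraTneq cz => ->; rewrite (eqP Ca) ltnn.
Qed.

Lemma theta_word_out z w a : (c < C a)%N -> a != z ->
  swap_word z n (fill col w) a = w a.
Proof.
move=> ca az; rewrite /swap_word tpermD 1?[_ == a]eq_sym //.
  by rewrite /fill /= gtn_eqF.
by apply: contraTneq ca => ->; rewrite Cn ltnn.
Qed.

Lemma theta_wordL z w : swap_word z n (fill col w) z = R n.
Proof. by rewrite /swap_word tpermL /fill /= Cn eqxx. Qed.

Lemma theta_wordR z w : (c < C z)%N -> swap_word z n (fill col w) n = w z.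
Proof. by move=> cz; rewrite /swap_word tpermR /fill /= gtn_eqF. Qed.

Lemma neq_n z : (c < C z)%N -> z != n.
Proof. by apply: contraTneq => ->; rewrite Cn ltnn. Qed.

Lemma theta_swap a b z w : (c < C a)%N -> (c < C b)%N ->
  swap_word (tperm a b z) n (fill col (swap_word a b w))
  =1 swap_word a b (swap_word z n (fill col w)).
Proof.
move=> ca cb y; rewrite -swap_wordJ [tperm a b n]tpermD ?neq_n //.
by rewrite /swap_word swap_fill.
Qed.

Lemma family_theta x : family c x -> family c.+1 (theta x).
Proof.
move=> xF; have [Hl Hc Hk Ha Hg] := xF; have cn := cn; split.
- move=> k ck w u wu; apply: (Hl n cn) => z; apply: swap_agree => //.
    exact: ltnW.
  exact: fill_agree.
- move=> k w ck /(Hc _ _ cn) /content_swap => cw.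
  by apply: content_fill; apply: cw => //; apply: ltnW.
- move=> k w r s ck sr; pose u := swap_word k n (fill col w).
  have := Hk n u r s cn sr; rewrite (reindex_inj (@perm_inj _ (tperm k n))) /=.
  under eq_bigl => z do rewrite (C_tperm _ (ltnW ck) cn) /u /swap_word tpermK.
  (* A term with [a] in column [c] vanishes. For [a = n] the letter [k] would lie below row [R n];
     otherwise [a] would share row [r] with [k], if [r = R n], or with another letter of [col']. *)
  rewrite big_column [X in X + _]big1 ?add0r => [E|a /andP[/eqP Ca fa]]; last first.
    have Ra : R a = s by move: fa; rewrite /fill /= Ca eqxx => /eqP.
    apply/eqP/negPn/negP => nz; have cu := Hc _ _ cn nz.
    have [an|an] := eqVneq a n.
      have := row_le (z := k) cu (ltnW ck).
      by rewrite an tpermR /set_letter eqxx leqNgt -an Ra sr.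
    have ka : k != a by apply: contraTneq ck => ->; rewrite Ca ltnn.
    have ca : (c <= C a)%N by rewrite Ca.
    move: nz cu; rewrite tpermD ?(eq_sym n) // => nz cu.
    have := row_le cu ca; rewrite /set_letter eqxx leq_eqVlt => /orP[/eqP rn|].
      have := bottom_unique (a := k) (z := a) cu (ltnW ck) ca.
      rewrite /set_letter eqxx (negPf ka) /u theta_wordL => /(_ erefl rn) ka'.
      by rewrite ka' eqxx in ka.
    move=> rn; have [b Cb Rb] := pos_up rn; rewrite Cn in Cb.
    have bn : b != n by apply: contraTneq rn => bn; rewrite -Rb bn ltnn.
    have ab : a != b by apply: contraTneq sr => ab; rewrite -Rb -ab Ra ltnn.
    case: (negP ab); apply/eqP/(alt_inj (Hl n cn) (bottom_alt xF) nz).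
    - by rewrite inE Ca eqxx.
    - by rewrite inE Cb eqxx.
    - rewrite /set_letter eqxx eq_sym (negPf ab) /u theta_word_in //=.
      by rewrite Cb eqxx.
  rewrite -[RHS]E; apply: eq_big => [z|z /andP[cz _]].
    by rewrite /fill /=; case: ltngtP.
  apply: Hl => // y cy; rewrite -swap_set_letter.
  by rewrite /swap_word set_fill.
- move=> k a b w ck ca cab ab; have cb : (c < C b)%N by rewrite -cab.
  rewrite /theta -(Ha n a b) ?(ltnW ca) // [tperm a b n]tpermD ?neq_n //.
  by apply: Hl => // z _; rewrite theta_swap.
- move=> k b d w ck cd db; rewrite /theta (Hg n b d) // ?(ltnW cd) //.
  apply: eq_bigr => a /eqP Ca; have ca : (c < C a)%N by rewrite Ca.
  have cb := ltn_trans cd db.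
  rewrite tpermD ?neq_n //; apply: Hl => // z _; rewrite theta_swap //.
Qed.

(** The letters of [col'] occupy each row above [R n] exactly once, so a single term survives when
    [X != 0]. *)
Lemma sum_row (r : nat) (X : F) : (X != 0 -> (r < R n)%N) ->
  \sum_(a | col' a) (r == R a)%:R * X = X.
Proof.
move=> Xr; have [->|/Xr rn] := eqVneq X 0.
  by rewrite big1 // => a _; rewrite mulr0.
have [a Ca Ra] := pos_up rn; rewrite Cn in Ca.
have an : a != n by apply: contraTneq rn => an; rewrite -Ra an ltnn.
rewrite (bigD1 a) /= ?Ca ?eqxx // Ra eqxx mul1r big1 ?addr0 //.
move=> b /andP[/andP[/eqP Cb _] ba]; case: eqP => [rb|_]; last by rewrite mul0r.
by case/eqP: ba; apply: pos_inj; rewrite ?Ra // Ca.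
Qed.

(** This is [fam_ker] at the word [v], obtained from [u] by raising [b] to row [R a]. The letters of
    [v] in that row are [a], [b], [n] if [w b = R a], and the [z] right of column [c] with
    [w z = R a]. Sending each in turn to row [R n] gives the swapped word, [u], [fill col w] and the
    words of [theta x z]. *)
Lemma garnir_term x a b w : family c x -> (c < C b)%N -> col' a ->
  - x n (swap_word a b (swap_word b n (fill col w)))
  = theta x b w + (w b == R a)%:R * x n (fill col w)
    + \sum_(z | (c < C z)%N && (z != b))
        (w z == R a)%:R * theta x z (swap_word z b w).
Proof.
move=> xF cb cola; have [/eqP Ca an] := andP cola.
pose u := swap_word b n (fill col w); pose v := set_letter u b (R a).
have ab : a != b by apply: contraTneq cb => <-; rewrite Ca ltnn.
have bn := neq_n cb; have xl := fam_local xF cn.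
have ua : u a = R a by apply: theta_word_in.
have := fam_ker xF v cn (R_lt cola).
rewrite big_mkcondr /= (bigD1 a) /= ?Ca // (bigD1 b) /= ?(ltnW cb) ?(eq_sym b) ?ab //.
rewrite (bigD1 n) /= ?cn 1?eq_sym ?an ?(eq_sym n) ?bn //.
have -> : v a = R a by rewrite /v /set_letter (negPf ab).
have -> : v b = R a by rewrite /v /set_letter eqxx.
have -> : v n = w b by rewrite /v /set_letter eq_sym (negPf bn) /u theta_wordR.
rewrite !eqxx => /eqP; rewrite addr_eq0 => /eqP E.
have -> : x n (swap_word a b u) = x n (set_letter v a (R n)).
  apply: xl => z _; rewrite /swap_word /v /set_letter.
  case: tpermP => [->|->|/eqP/negPf-> /eqP/negPf->] //.
    by rewrite eqxx /u theta_wordL.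
  by rewrite eq_sym (negPf ab) eqxx.
rewrite E opprK -addrA; congr (_ + (_ + _)).
- apply: xl => z _; rewrite /v /set_letter; case: eqP => // ->.
  by rewrite theta_wordL.
- case: eqP => [wb|]; rewrite ?mul0r // mul1r; apply: xl => z cz.
  rewrite /v /set_letter /u -wb /swap_word.
  case: eqP => [->|/eqP zn]; first by rewrite /fill /= Cn eqxx.
  case: eqP => [->|/eqP zb]; first by rewrite /fill /= gtn_eqF.
  by rewrite tpermD // eq_sym.
- rewrite [LHS]big_mkcond [RHS]big_mkcond; apply: eq_bigr => z _.
  case: (ltngtP c (C z)) => //= [cz|Cz]; last first.
    case: eqP => //= /eqP za; case: eqP => //= /eqP zb; case: eqP => //= /eqP zn.
    rewrite /v /set_letter (negPf zb) /u theta_word_in //=; last by rewrite Cz eqxx.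
    by case: eqP => // /pos_inj E'; rewrite E' ?eqxx // Ca in za.
  have za : z != a by apply: contraTneq cz => ->; rewrite Ca ltnn.
  rewrite za neq_n //=; case: eqP => //= /eqP zb.
  have -> : v z = w z by rewrite /v /set_letter (negPf zb) /u theta_word_out.
  case: eqP => [wz|]; rewrite ?mul0r // mul1r; apply: xl => y cy.
  rewrite /v /set_letter /u -wz.
  case: eqP => [->|/eqP yz]; first by rewrite theta_wordL.
  case: eqP => [->|/eqP yb].
    by rewrite theta_word_out 1?eq_sym // /swap_word tpermR.
  have [->|yn] := eqVneq y n.
    by rewrite !theta_wordR // /swap_word tpermL.
  move: cy; rewrite leq_eqVlt => /orP[/eqP Cy|cy].
    by rewrite !theta_word_in //= -Cy eqxx.
  by rewrite !theta_word_out // /swap_word tpermD // eq_sym.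
Qed.

(** In the Garnir relation for [x n] and [b], the letter [n] yields [erase x b] and the other
    letters are treated by [garnir_term]. Since |A| is [#|col'|.+1], the right-hand side is s +
    theta (L + |A|). *)
Lemma erase_theta x b w : family c x -> (c < C b)%N ->
  erase x b w = x n (fill col w) + jm c.+1 (theta x) b w
                + (#|col'|.+1)%:R * theta x b w.
Proof.
move=> xF cb; have xl := fam_local xF cn.
pose u := swap_word b n (fill col w).
have := fam_garnir xF u cn (leqnn c) cb; rewrite (bigD1 n) ?Cn //= tpermL.
have -> : x b (swap_word n b u) = erase x b w.
  apply: (fam_local xF (ltnW cb)) => z _.
  by rewrite /u /swap_word [tperm n b]tpermC tpermK.
rewrite -/(theta x b w) => E.
have {E} -> : erase x b w = theta x b w + \sum_(a | col' a) - x n (swap_word a b u).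
  rewrite E sumrN -addrA; apply/esym/eqP; rewrite addrC -subr_eq0 addrK.
  rewrite subr_eq0; apply/eqP/eq_bigr => a cola.
  rewrite tpermD //; first by case/andP: cola.
  exact: neq_n.
rewrite (eq_bigr _ (fun a => @garnir_term x a b w xF cb)) !big_split /=.
rewrite sumr_const sum_row => [|nz]; last first.
  have cf := fam_content xF cn nz.
  have <- : fill col w b = w b by rewrite /fill /= gtn_eqF.
  apply: (row_lt cf (ltnW cb) cn _ (neq_n cb)).
  by rewrite /fill /= Cn eqxx.
rewrite exchange_big /= -mulr_natl [_.+1%:R]mulrS mulrDl mul1r.
rewrite (eq_bigr (fun z => theta x z (swap_word z b w))) => [|z /andP[cz zb]].
  by rewrite -/(jm _ _ _ _); ring.
apply: sum_row => nz; have cf := fam_content xF cn nz.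
have <- : swap_word z n (fill col (swap_word z b w)) b = w z.
  by rewrite theta_word_out 1?eq_sym // /swap_word tpermR.
by apply: (row_lt cf (ltnW cb) (ltnW cz)); rewrite ?theta_wordL // eq_sym.
Qed.

(** The argument depends on the letter in row [R n]. If it is [n] or lies right of column [c],
    sorting the rest of the column leads to a hypothesis; if it lies in [col'], [fam_ker] reduces to
    the former case. *)
Lemma theta_inj x : family c x ->
  (forall w, x n (fill col w) = 0) ->
  (forall z w, (c < C z)%N -> theta x z w = 0) ->
  forall k w, (c <= C k)%N -> x k w = 0.
Proof.
move=> xF xn0 th0; have xl := fam_local xF cn.
have x0 k w : (c < C k)%N -> x k w = 0.
  move=> ck; move: w; apply: erase_inj => // w.
  rewrite erase_theta // xn0 th0 // mulr0 addr0 add0r /jm.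
  by apply: big1 => j /andP[cj _]; apply: th0.
have xn_top w z : (c <= C z)%N -> ~~ col' z -> w z = R n -> x n w = 0.
  move=> cz ncol wz.
  apply: (alt_sort xl (bottom_alt xF)) => [u a uw nz cola|].
    have ca : (c <= C a)%N by case/andP: cola => /eqP->.
    have uz : u z = R n by rewrite uw.
    have az : a != z by apply: contraTneq cola => ->.
    have rn := row_lt (fam_content xF cn nz) ca cz uz az.
    have [b Cb Rb] := pos_up rn; rewrite Cn in Cb; exists b => //=.
    by rewrite Cb eqxx /=; apply: contraTneq rn => bn; rewrite -Rb bn ltnn.
  move: cz; rewrite leq_eqVlt => /orP[/eqP Cz|cz].
    move: ncol; rewrite /= -Cz eqxx /= negbK => /eqP zn.
    rewrite -[RHS](xn0 w); apply: xl => t _; rewrite /fill /=.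
    by have [->|_] := eqVneq t n; rewrite ?andbT // andbF Cn eqxx -wz zn.
  rewrite -[RHS](th0 z (swap_word z n w) cz); apply: xl => t ct.
  rewrite /fill /=; have [->|tn] := eqVneq t n.
    by rewrite andbF theta_wordR // /swap_word tpermL.
  rewrite andbT; have [->|tz] := eqVneq t z; first by rewrite theta_wordL gtn_eqF.
  case: eqP => [Ct|/eqP Ct]; first by rewrite theta_word_in //= Ct eqxx.
  rewrite theta_word_out // ?ltn_neqAle 1?[c == _]eq_sym ?Ct //.
  by rewrite /swap_word tpermD // eq_sym.
apply: (family_eq0 xF x0) => w; apply/eqP/negPn/negP => nz.
have cw := fam_content xF cn nz.
have : (0 < #|[pred z | (c <= C z)%N && (w z == R n)]|)%N.
  by rewrite cw; apply/card_gt0P; exists n; rewrite inE cn eqxx.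
case/card_gt0P=> a; rewrite inE => /andP[ca /eqP wa].
have [cola|ncol] := boolP (col' a); last first.
  by rewrite (xn_top w a) ?eqxx in nz.
have [a1 Ca1 missed] := missed_row w.
have col1 : col' a1.
  by rewrite /= Ca1 eqxx; apply: contraNneq (missed _ cola) => ->; apply/eqP.
(* With [a] moved to row [R a1], no other letter of [col'] is in that row, so every term but that of
   [a] falls under [xn_top]. *)
have := fam_ker xF (set_letter w a (R a1)) cn (R_lt col1).
rewrite (bigD1 a) /= ?ca /set_letter ?eqxx // big1 => [|z].
  rewrite addr0 => E; case/eqP: nz; rewrite -[RHS]E; apply: xl => z _.
  by have [->|] := eqVneq z a.
case/andP=> /andP[cz]; have [//|za wz _] := eqVneq z a.
apply: (xn_top _ z) => //; rewrite ?eqxx //.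
by apply: contraTN wz => /missed.
Qed.

(** By [fam_alt] each [j] in [col'] contributes [- x n w], which the multiple of [x n w] cancels. *)
Lemma jm_bottom x w : family c x ->
  jm c x n w + #|col'|%:R * x n w
  = \sum_(j | (c < C j)%N) x j (swap_word j n w).
Proof.
move=> xF; have xl := fam_local xF cn.
rewrite /jm big_column [X in X + _ + _](eq_bigr (fun _ => - x n w)).
  rewrite sumr_const mulr_natl mulNrn addrAC addNr add0r.
  apply: eq_bigl => z; case: (ltngtP c (C z)) => //= cz.
  by rewrite neq_n.
move=> a /andP[/eqP Ca an]; rewrite -(fam_alt xF w cn _ _ an) ?Ca ?Cn //.
by rewrite tpermR.
Qed.

(** In each remaining word a letter right of column [c] is in row [R n]. With [theta_jm], this says
    that L + |A| - 1 maps [x] to the pair (0, [erase x]). *)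
Lemma jm_bottom_fill x w : family c x ->
  jm c x n (fill col w) + #|col'|%:R * x n (fill col w) = 0.
Proof.
move=> xF; rewrite jm_bottom //; apply: big1 => j cj.
apply: (bottom_row_eq0 (z := j)) => //; exact: theta_wordL.
Qed.

(** Only [j = z] survives, since any other swap leaves [z] in row [R n]. *)
Lemma theta_jm x z w : family c x -> (c < C z)%N ->
  theta (jm c x) z w + #|col'|%:R * theta x z w = erase x z w.
Proof.
move=> xF cz; rewrite jm_bottom // (bigD1 z) //= big1 => [|j /andP[cj jz]].
  rewrite addr0; apply: (fam_local xF (ltnW cz)) => t _.
  by rewrite /swap_word tpermK.
apply: (bottom_row_eq0 (z := z)) => //.
rewrite {1}/swap_word tpermD // 1?eq_sym ?neq_n //.
exact: theta_wordL.
Qed.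

End Strict.

End Bottom.

End Column.

(** Relations for the image of a polytabloid under an endomorphism of the whole Specht module, where
    no letter [k] is singled out. *)
Definition alternating c (v : (T -> nat) -> F) :=
  [/\ local c v, forall w, v w != 0 -> content c w
    & forall a b w, (c <= C a)%N -> C a = C b -> a != b ->
      v (swap_word a b w) = - v w].

Lemma alternating_fill c v :
  alternating c v -> alternating c.+1 (fun w => v (fill [pred z | C z == c] w)).
Proof.
case=> vl vc va; split=> [w u wu|w nz|a b w ca cab ab].
- by apply: vl; apply: fill_agree.
- by apply: content_fill; apply: vc.
- rewrite -(va a b) ?(ltnW ca) //; apply: vl => z _.
  by rewrite swap_fill -?cab.
Qed.

Lemma alternatingB c (l : F) v v' : alternating c v -> alternating c v' ->
  alternating c (fun w => v w - l * v' w).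
Proof.
case=> vl vc va [ul uc ua]; split=> [w w' ww|w|a b w ca cab ab].
- by rewrite (vl _ _ ww) (ul _ _ ww).
- have [/eqP v0|/vc //] := boolP (v w == 0).
  have [/eqP u0|/uc //] := boolP (v' w == 0).
  by rewrite v0 u0 mulr0 subrr eqxx.
- by rewrite va // ua // mulrN opprD.
Qed.

Lemma fill_R (P : pred T) z : fill P R z = R z.
Proof. by rewrite /fill; case: ifP. Qed.

(** Sorting column after column by [alt_sort] leaves only the word [R], so one value determines an
    alternating function. *)
Lemma alternating_scalar c v e : alternating c v -> alternating c e -> e R = 1 ->
  forall w, v w = v R * e w.
Proof.
have [m] : exists m, forall z, (C z < c + m)%N.
  exists (\max_z C z).+1 => z; rewrite addnS ltnS (leq_trans _ (leq_addl _ _)) //.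
  exact: leq_bigmax.
elim: m c v e => [|m IH] c v e Cm vA eA e1 w; have [vl vc va] := vA.
  have empty : forall z, (c <= C z)%N -> w z = R z.
    by move=> z; rewrite leqNgt -[c]addn0 Cm.
  by have [el _ _] := eA; rewrite (vl _ _ empty) (el _ _ empty) e1 mulr1.
have [ul uc ua] := alternatingB (v R) vA eA.
apply/eqP; rewrite -subr_eq0; apply/eqP.
have el : local c e by case: eA.
apply: (alt_sort (P := [pred z | C z == c]) ul) => [a b u /eqP Ca /eqP Cb ab|u a _ nz /eqP Ca|].
- by apply: ua; rewrite ?Ca ?Cb.
- by apply: col_row; [apply: uc|rewrite Ca].
- have fR : forall z, (c <= C z)%N -> fill [pred z | C z == c] R z = R z.
    by move=> z _; apply: fill_R.
  have := IH _ _ _ _ (alternating_fill vA) (alternating_fill eA).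
  rewrite /= (el _ _ fR) (vl _ _ fR) => -> //; first by rewrite subrr.
  by move=> z; rewrite addSnnS.
Qed.

Lemma family_alternating c x k : family c x -> (c <= C k)%N ->
  (forall j, x j = x k) -> alternating c (x k).
Proof.
move=> [Hl Hc _ Ha _] ck xk; split=> [|w|a b w ca cab ab]; first exact: Hl.
  exact: Hc.
by rewrite -(Ha k a b) // xk.
Qed.

(* Polynomials in jm c applied to the constant family e, in Horner form. *)
Inductive jm_span c (e : (T -> nat) -> F) : (T -> (T -> nat) -> F) -> Prop :=
| JmSpan0 x of (forall k w, (c <= C k)%N -> x k w = 0) : jm_span c e x
| JmSpanS x y a b of jm_span c e y &
    (forall k w, (c <= C k)%N -> x k w = a * e w + jm c y k w + b * y k w) :
  jm_span c e x.

Lemma jm_span_ext c e x y : (forall k w, (c <= C k)%N -> x k w = y k w) ->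
  jm_span c e x -> jm_span c e y.
Proof.
move=> xy xS; case: xS xy => [{}x x0|{}x x' a b x'S xE] xy.
  by constructor=> k w ck; rewrite -xy // x0.
by apply: (JmSpanS (a := a) (b := b) x'S) => k w ck; rewrite -xy // xE.
Qed.

Lemma family_step c e y a b : family c (fun _ => e) -> family c y ->
  family c (fun k w => a * e w + jm c y k w + b * y k w).
Proof.
move=> eF yF; have := familyD 1 b (familyD a 1 eF (family_jm yF)) yF.
by apply: family_ext => k w _; rewrite !mul1r.
Qed.

(** Under [erase] the larger Jucys-Murphy operator becomes the smaller one plus 1 ([erase_jm]); the
    coefficient [b - 1] makes up for this in each Horner step. *)
Lemma jm_span_lift c e x : family c (fun _ => e) ->
  jm_span c.+1 (fun w => e (fill [pred z | C z == c] w)) x ->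
  exists y, [/\ jm_span c e y, family c y
    & forall k w, (c < C k)%N -> erase c y k w = x k w].
Proof.
move=> eF; elim=> [{}x x0|{}x y a b _ [y' [yS yF yE]] xE].
  exists (fun _ _ => 0); split; [by constructor|exact: family0|].
  by move=> k w ck; rewrite x0.
exists (fun k w => a * e w + jm c y' k w + (b - 1) * y' k w); split.
- exact: JmSpanS yS _.
- exact: family_step.
- move=> k w ck; rewrite xE // -yE // /erase -/(erase c (jm c y') k w).
  rewrite erase_jm // [X in _ + (X + _) + _](_ : _ = jm c.+1 y k w).
    by rewrite /erase; ring.
  by apply: eq_bigr => j /andP[cj _]; apply: yE.
Qed.

Theorem family_jm_span c e x : family c (fun _ => e) -> e R = 1 -> family c x ->
  jm_span c e x.
Proof.
have [m] : exists m, forall z, (C z < c + m)%N.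
  exists (\max_z C z).+1 => z; rewrite addnS ltnS (leq_trans _ (leq_addl _ _)) //.
  exact: leq_bigmax.
elim: m c e x => [|m IH] c e x Cm eF e1 xF.
  by constructor=> k w; rewrite leqNgt -[c]addn0 Cm.
have [a0 ca0|empty] := pickP [pred z | (c <= C z)%N]; last first.
  by constructor=> k w ck; have := empty k; rewrite /= ck.
have [a1 Ca1] : exists a, C a == c.
  move: ca0; rewrite inE leq_eqVlt => /orP[/eqP->|/pos_left[a Ca _]].
    by exists a0.
  by exists a; apply/eqP.
case: (arg_maxnP (P := [pred z | C z == c]) R Ca1) => n /eqP Cn n_max'.
have n_max a : C a = c -> (R a <= R n)%N by move=> Ca; apply: n_max'; apply/eqP.
have cn : (c <= C n)%N by rewrite Cn.
have eA := family_alternating eF cn (fun _ => erefl).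
have [el _ _] := eA.
pose e' w := e (fill [pred z | C z == c] w).
have e'1 : e' R = 1 by rewrite -e1; apply: el => z _; apply: fill_R.
have e'F : family c.+1 (fun _ => e') := family_erase eF.
have Cm' z : (C z < c.+1 + m)%N by rewrite addSnnS.
(* If a later column reaches row [R n], then [erase x] determines [x], and the lift of [erase x]
   agrees with [x]. *)
have [/existsP[z /andP[cz /eqP Rz]]|/existsPn none] :=
    boolP [exists z, (c < C z)%N && (R z == R n)].
  have [y [yS yF yE]] := jm_span_lift eF (IH _ _ _ Cm' e'F e'1 (family_erase xF)).
  have zF := familyD 1 (-1) xF yF.
  have z0 k w : (c < C k)%N -> 1 * x k w + (-1) * y k w = 0.
    move=> ck; move: w; apply: (erase_inj zF ck) => w; rewrite /erase.
    by rewrite -/(erase c y k w) yE // mulN1r mul1r subrr.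
  have zn0 : forall w, 1 * x n w + (-1) * y n w = 0.
    by apply: (bottom_eq0_long Cn n_max zF) => //; exists z.
  apply: jm_span_ext yS => k w ck.
  have /eqP := family_eq0 Cn zF z0 zn0 w ck.
  by rewrite mul1r mulN1r subr_eq0 => /eqP.
have strict z : (c < C z)%N -> (R z < R n)%N.
  move=> cz; rewrite ltn_neqAle; have := none z; rewrite cz /= => ->.
  exact: (@row_le c n n_max R z (fun _ => erefl) (ltnW cz)).
have thF := family_theta Cn n_max strict xF.
have [y [yS yF yE]] := jm_span_lift eF (IH _ _ _ Cm' e'F e'1 thF).
pose s := x n (fill [pred z | C z == c] R).
have vA : alternating c.+1 (fun w => x n (fill [pred z | C z == c] w)).
  split=> [u v uv|u nz|a b u ca cab ab].
  - by apply: (fam_local xF cn); apply: fill_agree.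
  - by apply: content_fill; apply: fam_content nz.
  - have cb : (c < C b)%N by rewrite -cab.
    rewrite -(fam_alt xF _ cn (ltnW ca) cab ab) tpermD ?(neq_n Cn) //.
    by apply: (fam_local xF cn) => z _; rewrite swap_fill.
have sE := alternating_scalar vA (alternating_fill eA) e'1.
pose m' : F := #|[pred z | (C z == c) && (z != n)]|%:R.
have zF := familyD 1 (-1) xF (family_step s m' eF yF).
(* Here [m'] is |A| - 1, so [jm c y + m' y] has the pair (0, [erase c y]), and [erase c y] is the
   theta of [x]; the term [s * e] contributes the scalar part and has theta 0. *)
apply: (JmSpanS (a := s) (b := m') yS) => k w ck.
suff /eqP : 1 * x k w + (-1) * (s * e w + jm c y k w + m' * y k w) = 0.
  by rewrite mul1r mulN1r subr_eq0 => /eqP.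
move: k w ck; apply: (theta_inj Cn n_max strict zF) => [w|z w cz].
  by rewrite sE -/(e' w) -/s -addrA jm_bottom_fill // addr0 mul1r mulN1r subrr.
rewrite {1}/theta (bottom_row_eq0 Cn strict (u := swap_word _ _ _) (k := z) eF cz cz) ?theta_wordL //.
rewrite mulr0 add0r mul1r mulN1r.
have := theta_jm Cn strict w yF cz; rewrite /theta -/m' => ->.
by rewrite yE // subrr.
Qed.

(** * The constant family of a polytabloid *)

Section PolytabloidFamily.

Variable v : (T -> nat) -> F.
Hypothesis v_local : local 0 v.
Hypothesis v_alt : forall a b w, C a = C b -> a != b -> v (swap_word a b w) = - v w.
Hypothesis v_supp : forall w, v w != 0 ->
  exists2 p : {perm T}, (forall i, C (p i) = C i) & forall i, w (p i) = R i.

Lemma v_col_inj w a b : v w != 0 -> C a = C b -> w a = w b -> a = b.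
Proof.
move=> nz Cab; apply: (@alt_inj 0 [pred z | C z == C b] _ _ v_local _ nz); last first.
- by rewrite inE.
- by rewrite inE Cab.
by move=> a' b' u /eqP Ca' /eqP Cb'; apply: v_alt; rewrite Ca'.
Qed.

Lemma v_content w : v w != 0 -> content 0 w.
Proof.
move=> /v_supp[p Cp wp] r; rewrite -!sum1_card (reindex_inj (@perm_inj _ p)) /=.
by apply: eq_bigl => z; rewrite !inE wp.
Qed.

(** Column by column: if moving [z] to row [r] gives a word of the support, then exactly one other
    letter in the column of [z] has row [s], and the two terms differ by a swap, so they cancel. *)
Lemma v_ker w (r s : nat) : (s < r)%N ->
  \sum_(z | w z == s) v (set_letter w z r) = 0.
Proof.
move=> sr; pose M := \max_z C z.
have CM z : (inord (C z) : 'I_M.+1) = C z :> nat.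
  by rewrite inordK // ltnS; apply: (leq_bigmax z).
have CM_eq (y z : T) : (inord (C y) == inord (C z) :> 'I_M.+1) = (C y == C z).
  by rewrite -val_eqE /= !CM.
rewrite (partition_big (fun z => inord (C z) : 'I_M.+1) xpredT) //=.
apply: big1 => j _; apply/eqP/negPn/negP => nzS.
have [z] : exists z, [&& w z == s, inord (C z) == j & v (set_letter w z r) != 0].
  apply/existsP; apply: contraNT nzS; rewrite negb_exists => /forallP all0.
  apply/eqP/big1 => z /andP[ws Cj]; apply/eqP.
  by have := all0 z; rewrite ws Cj /= negbK.
case/and3P=> /eqP wz /eqP Cj nz; rewrite -{}Cj in nzS.
have [p Cp up] := v_supp nz; pose i := (p^-1)%g z.
have Ri : R i = r by rewrite -up permKV /set_letter eqxx.
have [i' Ci' Ri'] : exists2 i', C i' = C i & R i' = s by apply: pos_up; rewrite Ri.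
have Cz' : C (p i') = C z by rewrite Cp Ci' -Cp permKV.
have z'z : p i' != z.
  apply: contraTneq sr => E; have := up i'; rewrite Ri' E /set_letter eqxx => ->.
  by rewrite ltnn.
have wz' : w (p i') = s by have := up i'; rewrite Ri' /set_letter (negPf z'z).
case/negP: nzS; rewrite (bigD1 z) /= ?wz ?eqxx // (bigD1 (p i')) /=; last first.
  by rewrite wz' z'z CM_eq Cz' !eqxx.
rewrite big1 ?addr0 => [|y].
  have -> : v (set_letter w (p i') r) = v (swap_word (p i') z (set_letter w z r)).
    apply: v_local => t _; rewrite /set_letter /swap_word.
    case: tpermP => [->|->|/eqP/negPf-> /eqP/negPf->] //; rewrite ?eqxx //.
    by rewrite (negPf z'z) eq_sym (negPf z'z) wz wz'.
  by rewrite v_alt // subrr.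
rewrite CM_eq => /andP[/andP[/andP[/eqP wy /eqP Cy] yz] yz'].
case/eqP: yz'; apply: (v_col_inj nz); first by rewrite Cz'.
by rewrite /set_letter (negPf yz) (negPf z'z) wy wz'.
Qed.

(** In a word of the support exactly one letter of column [d] lies in the row of [b], and among the
    swaps with [b] only its swap gives a nonzero term. *)
Lemma v_garnir w b d : (d < C b)%N ->
  v w = \sum_(a | C a == d) v (swap_word a b w).
Proof.
move=> db; have g1 u : v u != 0 -> exists a,
    [/\ C a = d, v (swap_word a b u) = v u & 
     forall a', C a' = d -> a' != a -> v (swap_word a' b u) = 0].
  move=> nz; have [p Cp up] := v_supp nz; pose i := (p^-1)%g b.
  have [a0 Ca0 Ra0] : exists2 a0, C a0 = d & R a0 = R i.
    by apply: pos_left; rewrite -Cp permKV.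
  have ua : u (p a0) = u b by rewrite up Ra0 -up permKV.
  have Ca : C (p a0) = d by rewrite Cp.
  have neq_b a : C a = d -> a != b.
    by move=> Cad; apply: contraTneq db => <-; rewrite Cad ltnn.
  exists (p a0); split=> // [|a' Ca' a'a].
    by apply: v_local => z _; rewrite /swap_word; case: tpermP => [->|->|].
  apply/eqP/negPn/negP => nz'; case: (negP a'a); apply/eqP/(v_col_inj nz').
    by rewrite Ca.
  by rewrite /swap_word tpermL tpermD ?ua // [b == _]eq_sym neq_b.
have [/existsP[a0 /andP[/eqP Ca0 nz]]|/existsPn none] :=
    boolP [exists a, (C a == d) && (v (swap_word a b w) != 0)]; last first.
  rewrite big1 => [|a /eqP Ca]; last first.
    by apply/eqP; have := none a; rewrite Ca eqxx negbK.
  apply/eqP/negPn/negP => /[dup] nz /g1[a [Ca va _]].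
  by have := none a; rewrite Ca eqxx va nz.
have sum_u u : v u != 0 -> v u = \sum_(a | C a == d) v (swap_word a b u).
  case/g1=> a [Ca va rest]; rewrite (bigD1 a) /= ?Ca // va big1 ?addr0 //.
  by move=> a' /andP[/eqP Ca' a'a]; apply: rest.
(* The relation at [swap_word a0 b w] becomes the one at [w]: its other terms are those at [w] up to
   sign, by alternation in column [d]. *)
have := sum_u _ nz; rewrite (bigD1 a0) /= ?Ca0 //.
have -> : v (swap_word a0 b (swap_word a0 b w)) = v w.
  by apply: v_local => z _; rewrite /swap_word tpermK.
move=> E; rewrite [RHS](bigD1 a0) /= ?Ca0 // E -addrA -big_split /= big1 ?addr0 //.
move=> a /andP[/eqP Ca aa0].
have -> : v (swap_word a b (swap_word a0 b w))
        = v (swap_word a0 a (swap_word a b w)).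
  apply: v_local => z _; rewrite -swap_wordJ tpermR tpermD //.
  by apply: contraTneq db => ->; rewrite Ca0 ltnn.
by rewrite v_alt ?Ca ?Ca0 1?eq_sym // addNr.
Qed.

Lemma polytabloid_family : family 0 (fun _ => v).
Proof.
split=> [//|_ w _|_ w r s _|_ a b w _ _|_ b d w _ _].
- exact: v_content.
- exact: v_ker.
- exact: v_alt.
- exact: v_garnir.
Qed.

End PolytabloidFamily.

End Families.

(** * Block components *)

Section FittingIdempotent.

Variable F : fieldType.

(** Let the characteristic polynomial be q X^k with q prime to X, and u q + v X^(k+1) = 1. Then [h]
    is v(A), and h A^(k+1) is the Fitting projection onto the part where [A] is invertible. Closure
    of [P] under Horner steps gives [P h]. *)
Lemma fitting_idempotent n (A : 'M[F]_n) (P : 'M[F]_n -> Prop) :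
  P 0 -> (forall B a, P B -> P (B *m A + a%:M)) ->
  exists h k, [/\ P h, h *m A = A *m h,
    A ^+ k.+1 *m (h *m A ^+ k.+1) = A ^+ k.+1
    & (h *m A ^+ k.+1) *m (h *m A ^+ k.+1) = h *m A ^+ k.+1].
Proof.
case: n => [|n] in A P * => P0 PS.
  by exists 0, 0%N; split=> //; apply/matrixP=> -[].
have PP (p : {poly F}) : P (horner_mx A p).
  elim/poly_ind: p => [|p a IH]; first by rewrite raddf0.
  by rewrite rmorphD rmorphM /= horner_mx_X horner_mx_C; apply: PS.
have [k [q nz_q def_p]] := multiplicity_XsubC (char_poly A) 0.
rewrite subr0 in def_p; rewrite monic_neq0 ?char_poly_monic //= in nz_q.
have : coprimep q ('X ^+ k.+1).
  by rewrite coprimep_expr // coprimepX.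
case/Bezout_eq1_coprimepP=> [[u v] /= def1].
have qX0 : horner_mx A (q * 'X ^+ k.+1) = 0.
  rewrite exprSr mulrA -def_p rmorphM /= Cayley_Hamilton; exact: mul0r.
have AX : horner_mx A ('X ^+ k.+1) = A ^+ k.+1.
  by rewrite rmorphXn /= horner_mx_X.
have qX0' p : horner_mx A (p * (q * 'X^(k.+1))) = 0 by rewrite rmorphM /= qX0 mulr0.
exists (horner_mx A v), k; split; first exact: PP.
- transitivity (horner_mx A (v * 'X)); first by rewrite rmorphM /= horner_mx_X.
  by rewrite mulrC rmorphM /= horner_mx_X.
- rewrite -AX !mulmxE -!rmorphM /=.
  have -> : 'X^(k.+1) * (v * 'X^(k.+1)) = 'X^(k.+1) - u * (q * 'X^(k.+1)).
    by rewrite -[X in _ = X - _]mulr1 -def1; ring.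
  by rewrite rmorphB /= qX0' subr0.
- rewrite -AX !mulmxE -!rmorphM /=.
  have -> : v * 'X^(k.+1) * (v * 'X^(k.+1))
          = v * 'X^(k.+1) - v * u * (q * 'X^(k.+1)).
    by rewrite -[X in _ = X - _]mulr1 -def1; ring.
  by rewrite rmorphB /= qX0' subr0.
Qed.

End FittingIdempotent.

Section BlockIndecomposable.

Variables (F : fieldType) (gT : finGroupType) (G : {group gT}).
Variables (d : nat) (rG : mx_representation F G d).

Local Notation Z_G := ('Z(group_ring F G))%MS.

Definition central_action (A : 'M[F]_d) :=
  exists2 z, (z \in Z_G)%MS & gring_op rG z = A.

Lemma center_mx1 : (1%:M \in Z_G)%MS.
Proof.
apply/center_mxP; split=> [|B _]; first exact: envelop_mx1.
by rewrite mulmx1 mul1mx.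
Qed.

Lemma center_mxM y z : (y \in Z_G)%MS -> (z \in Z_G)%MS -> (y *m z \in Z_G)%MS.
Proof.
move=> /center_mxP[Ry Cy] /center_mxP[Rz Cz]; apply/center_mxP.
split=> [|B RB]; first exact: envelop_mxM.
by rewrite mulmxA Cy // -!mulmxA Cz.
Qed.

Lemma center_mxD (a : F) y z :
  (y \in Z_G)%MS -> (z \in Z_G)%MS -> (a *: y + z \in Z_G)%MS.
Proof. by move=> Zy Zz; rewrite linearP /= addmx_sub // scalemx_sub. Qed.

Lemma gring_opX z k : (z \in group_ring F G)%MS ->
  gring_op rG (z ^+ k) = gring_op rG z ^+ k.
Proof.
move=> Rz; elim: k => [|k IH]; first by rewrite !expr0 gring_op1.
by rewrite !exprSr -!mulmxE gring_opM // IH.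
Qed.

(** The projection onto a summand is the action of a central [z]. The Fitting idempotent [w] of [z]
    is central and acts as the same projection, so [b] splits into the orthogonal idempotents
    [w *m b] and [b - w *m b], one of which is 0. *)
Lemma block_indecomposable b :
  block_idempotent b ->
  (forall A, (forall g, g \in G -> A *m rG g = rG g *m A) -> central_action A) ->
  mod_mul rG b = 0 \/ mxindecomposable rG (mod_mul rG b).
Proof.
case=> -[Zb bb] _ b_prim endo; rewrite /mod_mul.
have [Rb Cb] := center_mxP Zb.
set U := gring_op rG b; have [->|nzU] := eqVneq U 0; [by left | right].
have UU : U *m U = U by rewrite -gring_opM // bb.
have UG g : g \in G -> rG g *m U = U *m rG g.
  move=> Gg; rewrite -(gring_opG rG Gg) -!gring_opM ?envelop_mx_id //.
  by rewrite Cb // envelop_mx_id.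
have U_id m (W : 'M_(m, d)) : (W <= U)%MS -> W *m U = W.
  by case/submxP=> D ->; rewrite -mulmxA UU.
split=> // [|A B modA modB defU dxAB].
  by apply/mxmoduleP=> g Gg; rewrite -UG // submxMl.
pose E := U *m proj_mx A B.
have homE g : g \in G -> E *m rG g = rG g *m E.
  move=> Gg; rewrite /E mulmxA UG //; apply/esym/(hom_mxP _ g Gg).
  by rewrite -defU; apply: proj_mx_hom.
have sAU : (A <= U)%MS by rewrite -defU addsmxSl.
have sBU : (B <= U)%MS by rewrite -defU addsmxSr.
have EU : E *m U = E.
  by apply: U_id; apply: submx_trans sAU; apply: proj_mx_sub.
have AE : A *m E = A by rewrite mulmxA U_id // proj_mx_id.
have BE : B *m E = 0 by rewrite mulmxA U_id // proj_mx_0.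
have EE : E *m E = E.
  have /submxP[D defE] : (E <= A)%MS := proj_mx_sub _ _ _.
  by rewrite {1 3}defE -mulmxA AE.
have Ek k : E ^+ k.+1 = E.
  by elim: k => [|k IH]; rewrite ?expr1 // exprS IH.
have [z Zz zE] := endo E homE; have [Rz _] := center_mxP Zz.
have [||h [k [Zh hz zw ww]]] := @fitting_idempotent F _ z (fun M => M \in Z_G)%MS.
- by rewrite linear0 sub0mx.
- move=> M a ZM; rewrite addrC -scalemx1; apply: center_mxD.
    exact: center_mx1.
  exact: center_mxM.
set w := h *m z ^+ k.+1 in zw ww.
have Zzk j : (z ^+ j \in Z_G)%MS.
  by elim: j => [|j IH]; rewrite ?exprS; [apply: center_mx1 | apply: center_mxM].
have Zw : (w \in Z_G)%MS by apply: center_mxM.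
have [[Rh _] [Rw Cw]] := (center_mxP Zh, center_mxP Zw).
have Rzk j := (center_mxP (Zzk j)).1.
(* Powers of [E] equal [E], so [zw] reads [E = E *m gring_op rG w]; the right-hand side is
   [gring_op rG w] because [h] commutes with [z]. *)
have wE : gring_op rG w = E.
  have: gring_op rG (z ^+ k.+1 *m w) = E by rewrite zw gring_opX // zE Ek.
  rewrite gring_opM // gring_opX // zE Ek => <-.
  rewrite gring_opM // gring_opX // zE Ek mulmxA.
  by rewrite -{2}zE -gring_opM // -hz gring_opM // zE -mulmxA EE.
clearbody w; have Zwb := center_mxM Zw Zb; have [Rwb Cwb] := center_mxP Zwb.
have wbE : gring_op rG (w *m b) = E by rewrite gring_opM // wE.
have wbwb : w *m b *m (w *m b) = w *m b.
  by rewrite mulmxA -(mulmxA w b w) (Cw b Rb) !mulmxA ww -mulmxA bb.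
have bwb : b *m (w *m b) = w *m b by rewrite mulmxA Cw // -mulmxA bb.
have wbb : w *m b *m b = w *m b by rewrite -mulmxA bb.
case: (b_prim (w *m b) (b - w *m b)).
- by split.
- split; first by rewrite addrC -scaleN1r; apply: center_mxD.
  by rewrite mulmxBl !mulmxBr bb bwb wbb wbwb subrr subr0.
- by rewrite mulmxBr wbb wbwb subrr.
- by rewrite mulmxBl bwb wbwb subrr.
- by rewrite addrC subrK.
- by move=> wb0; left; rewrite -AE -wbE wb0 linear0 mulmx0.
- move=> bwb0; right; have UE : U = E.
    by rewrite -wbE; apply/eqP; rewrite -subr_eq0 -linearB bwb0 linear0.
  by rewrite -(U_id _ B sBU) UE BE.
Qed.

End BlockIndecomposable.

(** * Specht modules *)

Section Positions.

Variables (n : nat) (la : seq nat).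
Hypothesis la_sorted : sorted geq la.
Implicit Types (t : tableau n la).

Lemma node_inj (x y : node la) :
  node_row x = node_row y :> nat -> node_col x = node_col y -> x = y.
Proof.
case: x y => [r c] [r' c'] /= /val_inj rr'; case: r' / rr' c' => c' cc'.
by congr existT; apply: val_inj.
Qed.

Lemma tab_surj t i : i \in codom (val t).
Proof. by have /andP[_ /forallP] := valP t. Qed.

Lemma tab_inj t : injective (val t).
Proof. by have /andP[/injectiveP] := valP t. Qed.

Definition pos t i : node la := iinv (tab_surj t i).

Lemma posK t : cancel (pos t) (val t).
Proof. by move=> i; apply: f_iinv. Qed.

Lemma tabK t : cancel (val t) (pos t).
Proof. by move=> x; apply: (tab_inj (t := t)); rewrite posK. Qed.

Definition row_of t (i : 'I_n) : nat := node_row (pos t i).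
Definition col_of t (i : 'I_n) : nat := node_col (pos t i).

Lemma row_col_inj t a b : row_of t a = row_of t b -> col_of t a = col_of t b -> a = b.
Proof. by move=> rab cab; rewrite -(posK t a) (node_inj rab cab) posK. Qed.

Lemma has_letter t (r c : nat) : (c < nth 0 la r)%N ->
  exists2 b, col_of t b = c & row_of t b = r.
Proof.
move=> cr; have rs : (r < size la)%N.
  by rewrite ltnNge; apply: contraTN cr => sr; rewrite nth_default.
pose x : node la := Tagged (fun r : 'I_(size la) => 'I_(nth 0%N la r))
  (Ordinal cr : 'I_(nth 0%N la (Ordinal rs))).
by exists (val t x); rewrite /col_of /row_of tabK.
Qed.

Lemma letter_in t a : (col_of t a < nth 0 la (row_of t a))%N.
Proof. by rewrite /col_of /row_of; case: (pos t a) => r c /=; apply: ltn_ord. Qed.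

Lemma has_letter_above t a (r : nat) : (r < row_of t a)%N ->
  exists2 b, col_of t b = col_of t a & row_of t b = r.
Proof.
move=> ra; apply: has_letter; apply: leq_trans (letter_in t a) _.
have sa : (row_of t a < size la)%N by rewrite /row_of.
have /(sorted_ltn_nth) : transitive geq by move=> x y z xy yz; apply: leq_trans yz xy.
by move/(_ 0 _ la_sorted r (row_of t a)); apply; rewrite ?inE // (ltn_trans ra).
Qed.

Lemma has_letter_left t a c : (c < col_of t a)%N ->
  exists2 b, col_of t b = c & row_of t b = row_of t a.
Proof. by move=> ca; apply: has_letter; apply: ltn_trans ca (letter_in t a). Qed.

Lemma row_of_act t p i : row_of (tab_act t p) i = row_of t ((p^-1)%g i).
Proof.
rewrite /row_of; congr (nat_of_ord (node_row _)); apply: (tab_inj (t := tab_act t p)).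
by rewrite posK /= ffunE posK permKV.
Qed.

Lemma card_row t t' (r : nat) :
  #|[pred i | row_of t i == r]| = #|[pred i | row_of t' i == r]|.
Proof.
have E s : #|[pred i | row_of s i == r]| = #|[pred x : node la | node_row x == r :> nat]|.
  rewrite -!sum1_card (reindex (val s)) /=; last first.
    by exists (pos s) => x _; rewrite ?tabK ?posK.
  by apply: eq_bigl => x; rewrite !inE /row_of tabK.
by rewrite !E.
Qed.

Lemma tab_transitive t t' : exists p, t' = tab_act t p.
Proof.
have pI : injective (fun i => val t' (pos t i)).
  by move=> i j /tab_inj /(congr1 (val t)); rewrite !posK.
exists (perm pI); apply: val_inj; apply/ffunP=> x.
by rewrite /= ffunE permE tabK.
Qed.

Lemma mem_row_parts t i u : (i \in row_parts t u) = (row_of t i == u).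
Proof.
rewrite ffunE; apply/imsetP/eqP => [[x] | iu].
  by rewrite inE => /eqP <- ->; rewrite /row_of tabK.
by exists (pos t i); rewrite ?posK // inE -val_eqE /= -/(row_of t i) iu.
Qed.

Lemma mem_tab_col t i c : (i \in tab_col t c) = (col_of t i == c).
Proof.
apply/imsetP/eqP => [[x] | iu].
  by rewrite inE => /eqP <- ->; rewrite /col_of tabK.
by exists (pos t i); rewrite ?posK // inE -/(col_of t i) iu.
Qed.

Lemma mem_col_stab t (p : 'S_n) :
  (p \in col_stab t) = [forall i, col_of t (p i) == col_of t i].
Proof.
rewrite inE; apply/forallP/forallP => H.
  move=> i; rewrite -mem_tab_col -(eqP (H (pos t i))).
  by apply: imset_f; rewrite mem_tab_col.
move=> x; rewrite eqEcard card_imset ?leqnn ?andbT; last exact: perm_inj.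
apply/subsetP=> _ /imsetP[i + ->]; rewrite !mem_tab_col => /eqP <-.
exact: H.
Qed.

End Positions.

(** * Vectors of M^lambda as functions on words *)

Section Coefficients.

Variables (F : fieldType) (n : nat) (la : seq nat).
Local Notation Tabloid := (tabloid n la).
Implicit Types (w : 'I_n -> nat) (t : tableau n la).

Definition fits (U : Tabloid) w :=
  [forall i, forall u, (i \in val U u) == (w i == u :> nat)].

(** At most one tabloid fits [w], so this is the coefficient of [v] at that tabloid, and 0 if there
    is none. *)
Definition coef (v : 'rV[F]_#|{: Tabloid}|) w : F :=
  \sum_U v 0 (enum_rank U) * (fits U w)%:R.

Lemma fits_tabloid_of t w : fits (tabloid_of t) w = [forall i, w i == row_of t i].
Proof.
apply/forallP/forallP => H i.
  have /forallP/(_ (node_row (pos t i))) := H i.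
  by rewrite mem_row_parts eqxx => /eqP/esym.
by apply/forallP=> u; rewrite mem_row_parts (eqP (H i)).
Qed.

Lemma tabloid_ofP (U : Tabloid) : exists t, U = tabloid_of t.
Proof. by have /existsP[t /eqP E] := valP U; exists t; apply: val_inj. Qed.

Lemma fits_inj (U U' : Tabloid) w : fits U w -> fits U' w -> U = U'.
Proof.
move=> /forallP f /forallP f'; apply: val_inj; apply/ffunP=> u.
apply/setP=> i; have /forallP/(_ u)/eqP -> := f i.
by have /forallP/(_ u)/eqP -> := f' i.
Qed.

Lemma fits_act U p w : fits (tabloid_act U p) w = fits U (fun i => w (p i)).
Proof.
apply/forallP/forallP => H i; apply/forallP=> u.
  have /forallP/(_ u)/eqP <- := H (p i); rewrite ffunE.
  by rewrite (mem_imset _ _ (@perm_inj _ p)).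
have /forallP/(_ u) := H ((p^-1)%g i); rewrite permKV => /eqP <-.
by rewrite ffunE -{1}[i](permKV p) (mem_imset _ _ (@perm_inj _ p)).
Qed.

Lemma eq_fits U w w' : w =1 w' -> fits U w = fits U w'.
Proof. by move=> ww; apply: eq_forallb => i; apply: eq_forallb => u; rewrite ww. Qed.

Lemma eq_coef v w w' : w =1 w' -> coef v w = coef v w'.
Proof. by move=> ww; apply: eq_bigr => U _; rewrite (eq_fits U ww). Qed.

Lemma coefZD w a u v : coef (a *: u + v) w = a * coef u w + coef v w.
Proof.
rewrite /coef mulr_sumr -big_split /=; apply: eq_bigr => U _.
by rewrite !mxE mulrDl mulrA.
Qed.

Lemma coef_sum w (I : finType) (P : pred I) (a : I -> F) v :
  coef (\sum_(i | P i) a i *: v i) w = \sum_(i | P i) a i * coef (v i) w.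
Proof.
rewrite /coef; under eq_bigr => U _ do rewrite summxE mulr_suml.
rewrite exchange_big; apply: eq_bigr => i _; rewrite mulr_sumr.
by apply: eq_bigr => U _; rewrite mxE mulrA.
Qed.

Lemma coef_tabloid U w : coef (tabloid_vec F U) w = (fits U w)%:R.
Proof.
rewrite /coef (bigD1 U) //= mxE !eqxx mul1r big1 ?addr0 // => U' U'U.
by rewrite mxE (inj_eq enum_rank_inj) (negPf U'U) andbF mul0r.
Qed.

Lemma tabloid_vec_sum (v : 'rV[F]_#|{: Tabloid}|) : v = \sum_U v 0 (enum_rank U) *: tabloid_vec F U.
Proof.
apply/rowP=> j; rewrite -(enum_valK j); move: (enum_val j) => U {j}.
rewrite summxE (bigD1 U) //= mxE mxE !eqxx mulr1 big1 ?addr0 // => U' U'U.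
by rewrite mxE mxE (inj_eq enum_rank_inj) eq_sym (negPf U'U) andbF mulr0.
Qed.

Lemma coef_act v p w : coef (v *m tabloid_mx F la p) w = coef v (fun i => w (p i)).
Proof.
rewrite {1}[v]tabloid_vec_sum mulmx_suml.
under eq_bigr => U _ do rewrite -scalemxAl tabloid_vec_act.
by rewrite coef_sum; apply: eq_bigr => U _; rewrite coef_tabloid fits_act.
Qed.

Lemma coef_fits v w : coef v w != 0 -> exists t, w =1 row_of t.
Proof.
move=> nz; have /existsP[U fU] : [exists U, fits U w].
  apply: contraNT nz; rewrite negb_exists => /forallP none.
  by rewrite /coef big1 // => U _; rewrite (negPf (none U)) mulr0.
have [t E] := tabloid_ofP U; exists t => i.
by move: fU; rewrite E fits_tabloid_of => /forallP/(_ i)/eqP.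
Qed.

Lemma coef_inj v : (forall w, coef v w = 0) -> v = 0.
Proof.
move=> v0; apply/rowP=> j; rewrite mxE -(enum_valK j).
have [t E] := tabloid_ofP (enum_val j).
have fit : fits (tabloid_of t) (row_of t).
  by rewrite fits_tabloid_of; apply/forallP.
rewrite -[RHS](v0 (row_of t)) /coef (bigD1 (enum_val j)) //= E fit mulr1.
rewrite big1 ?addr0 // => U UE; case fU: (fits U _); last by rewrite mulr0.
by case/eqP: UE; apply: fits_inj fU fit.
Qed.

Lemma coef_local v (C : 'I_n -> nat) : local C 0 (coef v).
Proof. by move=> w u wu; apply: eq_coef => i; apply: wu. Qed.

Lemma coef_content v w t : coef v w != 0 -> content (row_of t) (col_of t) 0 w.
Proof.
case/coef_fits=> t' wt' r; rewrite -[RHS](card_row t') -!sum1_card.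
by apply: eq_bigl => z; rewrite !inE wt'.
Qed.

Lemma coef_polytabloid t w : coef (polytabloid F t) w =
  \sum_(p in col_stab t) (-1) ^+ p * [forall i, w (p i) == row_of t i]%:R.
Proof.
rewrite /polytabloid coef_sum; apply: eq_bigr => p _.
rewrite coef_tabloid fits_tabloid_of; congr (_ * (nat_of_bool _)%:R).
apply/forallP/forallP => H i; last by rewrite row_of_act -(eqP (H _)) permKV.
by rewrite (eqP (H _)) row_of_act permK.
Qed.

Lemma coef_polytabloid_alt t a b w : col_of t a = col_of t b -> a != b ->
  coef (polytabloid F t) (swap_word a b w) = - coef (polytabloid F t) w.
Proof.
move=> Cab ab; rewrite !coef_polytabloid -sumrN (reindex_inj (mulIg (tperm a b))) /=.
apply: eq_big => [p|p _].
  rewrite !mem_col_stab; apply: eq_forallb => i; rewrite permM.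
  by case: tpermP => [->|->|]; rewrite ?Cab.
rewrite odd_permM odd_tperm ab addbT signrN mulNr; congr (- (_ * (nat_of_bool _)%:R)).
by apply: eq_forallb => i; rewrite /swap_word permM tpermK.
Qed.

Lemma coef_polytabloid_supp t w : coef (polytabloid F t) w != 0 ->
  exists2 p : 'S_n, (forall i, col_of t (p i) = col_of t i)
    & forall i, w (p i) = row_of t i.
Proof.
rewrite coef_polytabloid => nz.
have /existsP[p /andP[]] : [exists p, (p \in col_stab t) && [forall i, w (p i) == row_of t i]].
  apply: contraNT nz; rewrite negb_exists => /forallP none.
  rewrite big1 // => p pt; have := none p; rewrite pt /= => /negPf->.
  by rewrite mulr0.
rewrite mem_col_stab => /forallP Cp /forallP wp.
by exists p => i; apply/eqP.
Qed.

(** A column permutation that preserves the rows is trivial, so only the identity contributes. *)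
Lemma coef_polytabloid1 t : coef (polytabloid F t) (row_of t) = 1.
Proof.
rewrite coef_polytabloid (bigD1 1%g) /=; last first.
  by rewrite mem_col_stab; apply/forallP=> i; rewrite perm1.
rewrite odd_perm1 mul1r (_ : [forall i, _] = true); last first.
  by apply/forallP=> i; rewrite perm1.
rewrite big1 ?addr0 // => p /andP[]; rewrite mem_col_stab => /forallP Cp p1.
case: forallP => [Rp|_]; last by rewrite mulr0.
case/eqP: p1; apply/permP=> i; rewrite perm1.
by apply: (row_col_inj (t := t)); apply/eqP.
Qed.

Lemma specht_sum v : (v <= specht_mx F n la)%MS ->
  exists a : tableau n la -> F, v = \sum_t a t *: polytabloid F t.
Proof.
case/sub_sumsmxP=> u ->.
have H t : exists a, u t *m <<polytabloid F t>>%MS == a *: polytabloid F t.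
  have : (u t *m <<polytabloid F t>> <= polytabloid F t)%MS.
    by rewrite -(genmxE (polytabloid F t)) submxMl.
  by case/sub_rVP=> a ->; exists a.
exists (fun t => xchoose (H t)); apply: eq_bigr => t _.
exact/eqP/(xchooseP (H t)).
Qed.

End Coefficients.

(** The polynomials in [L], in the same Horner form as [jm_span]. *)
Inductive mx_span (F : fieldType) d (L : 'M[F]_d) : 'M[F]_d -> Prop :=
| MxSpan0 : mx_span L 0
| MxSpanS Y a b of mx_span L Y : mx_span L (a%:M + L *m Y + b *: Y).

(** * Conjugates of an endomorphism of the restriction *)

Section Twist.

Variables (F : fieldType) (n d : nat).
Variable V : mx_representation F [set: 'S_n.+1] d.
Implicit Types (X : 'M[F]_d) (k : 'I_n.+1) (p : 'S_n.+1).

Definition fixes_max_comm X :=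
  forall p, p ord_max = ord_max -> X *m V p = V p *m X.

(* If X commutes with the stabiliser of ord_max then this conjugate of X commutes
   with the stabiliser of k. *)
Definition twist X k m (W : 'M[F]_(m, d)) :=
  W *m V (tperm k ord_max) *m X *m V (tperm k ord_max).

Definition jm_mx : 'M[F]_d := \sum_(j | j != ord_max) V (tperm j ord_max).

Lemma repr_permM p q : V (p * q)%g = V p *m V q.
Proof. by rewrite repr_mxM ?inE. Qed.

(** The transpositions [g] and [g'] exchange [k] and [p k] with [ord_max], so [h = g * p * g'] fixes
    [ord_max] and commutes with [X]. *)
Lemma twist_act X k p m (W : 'M[F]_(m, d)) : fixes_max_comm X ->
  twist X (p k) (W *m V p) = twist X k W *m V p.
Proof.
move=> cX; pose g := tperm k ord_max; pose g' := tperm (p k) ord_max.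
pose h := (g * p * g')%g.
have hmax : h ord_max = ord_max by rewrite !permM tpermR tpermL.
rewrite /twist -/g -/g' -(mulmxA W) -repr_permM.
have -> : (p * g' = g * h)%g by rewrite /h !mulgA tperm2 mul1g.
rewrite repr_permM mulmxA -[_ *m V h *m X]mulmxA -cX // mulmxA.
rewrite -[_ *m V h *m V g']mulmxA -repr_permM.
have -> : (h * g' = g * p)%g by rewrite /h -mulgA tperm2 mulg1.
by rewrite repr_permM !mulmxA.
Qed.

Lemma twist_sum X k m (P : pred 'I_n.+1) (f : 'I_n.+1 -> 'M[F]_(m, d)) :
  twist X k (\sum_(i | P i) f i) = \sum_(i | P i) twist X k (f i).
Proof. by rewrite /twist !mulmx_suml. Qed.

Lemma jm_mx_comm p : p ord_max = ord_max -> jm_mx *m V p = V p *m jm_mx.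
Proof.
move=> pmax; rewrite /jm_mx mulmx_suml mulmx_sumr [RHS](reindex_inj (@perm_inj _ p)).
apply: eq_big => [j|j _]; first by rewrite -[in RHS]pmax (inj_eq perm_inj).
by rewrite -!repr_permM -[in RHS]pmax -tpermJ conjgE mulKVg.
Qed.

Lemma twist_scalar a k m (W : 'M[F]_(m, d)) : twist a%:M k W = a *: W.
Proof.
rewrite /twist mul_mx_scalar -scalemxAl -mulmxA -repr_permM tperm2.
by rewrite repr_mx1 mulmx1.
Qed.

Lemma twistD X Y k m (W : 'M[F]_(m, d)) :
  twist (X + Y) k W = twist X k W + twist Y k W.
Proof. by rewrite /twist mulmxDr mulmxDl. Qed.

Lemma twistZ a X k m (W : 'M[F]_(m, d)) : twist (a *: X) k W = a *: twist X k W.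
Proof. by rewrite /twist -scalemxAr -scalemxAl. Qed.

(** Conjugation by (k ord_max) takes the transpositions moving [ord_max] to those moving [k]; the
    result is the matrix counterpart of [jm]. *)
Lemma twist_jm X k m (W : 'M[F]_(m, d)) :
  twist (jm_mx *m X) k W = \sum_(j | j != k) twist X k (W *m V (tperm j k)).
Proof.
set g := tperm k ord_max.
have E : W *m V g *m jm_mx = \sum_(j | j != k) W *m V (tperm j k) *m V g.
  rewrite /jm_mx mulmx_sumr [RHS](reindex_inj (@perm_inj _ g)) /=.
  apply: eq_big => [j|j _]; first by rewrite -(inj_eq (@perm_inj _ g)) tpermR.
  rewrite -!mulmxA -!repr_permM; congr (_ *m V _).
  have -> : tperm (g j) k = (tperm j ord_max ^ g)%g by rewrite tpermJ [g ord_max]tpermR.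
  by rewrite conjgE tpermV -!mulgA tperm2 mulg1.
by rewrite /twist mulmxA E !mulmx_suml.
Qed.

Lemma mx_span_comm X : mx_span jm_mx X -> fixes_max_comm X.
Proof.
elim=> [p _|Y a b _ IH p pmax]; first by rewrite mul0mx mulmx0.
rewrite !mulmxDl !mulmxDr -scalemxAl -scalemxAr IH // scalar_mxC.
by rewrite -mulmxA IH // !mulmxA jm_mx_comm.
Qed.

End Twist.

(** * Endomorphisms of the Specht module and of its restriction *)

Section SpechtEndomorphisms.

Variables (F : fieldType) (n : nat) (la : seq nat).
Hypothesis two_neq0 : 2%:R != 0 :> F.
Hypothesis la_sorted : sorted geq la.

Local Notation V := (specht_repr F n.+1 la).
Local Notation d := (\rank (specht_mx F n.+1 la)).
Local Notation letter := 'I_n.+1.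
Implicit Types (t : tableau n.+1 la) (u : 'rV[F]_d) (p : 'S_n.+1).

Definition ev u (w : letter -> nat) : F :=
  coef (val_submod (U := specht_mx F n.+1 la) u) w.

Lemma evZD w a u u' : ev (a *: u + u') w = a * ev u w + ev u' w.
Proof. by rewrite /ev linearP coefZD. Qed.

Lemma ev0 w : ev 0 w = 0.
Proof. by rewrite /ev linear0 /coef big1 // => U _; rewrite mxE mul0r. Qed.

Lemma evN w u : ev (- u) w = - ev u w.
Proof. by rewrite -[- u]addr0 -scaleN1r evZD ev0 addr0 mulN1r. Qed.

Lemma ev_inj u : (forall w, ev u w = 0) -> u = 0.
Proof. by move/coef_inj/eqP; rewrite val_submod_eq0 => /eqP. Qed.

Lemma ev_act u p w : ev (u *m V p) w = ev u (fun i => w (p i)).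
Proof. by rewrite /ev val_submodJ ?inE // coef_act. Qed.

Lemma ev_sum w (P : pred letter) (f : letter -> 'rV[F]_d) :
  ev (\sum_(i | P i) f i) w = \sum_(i | P i) ev (f i) w.
Proof.
rewrite /ev linear_sum -[RHS](eq_bigr _ (fun i _ => mul1r _)) -coef_sum.
by under [in RHS]eq_bigr => i _ do rewrite scale1r.
Qed.

Lemma family_polytabloid t :
  family (row_of t) (col_of t) 0 (fun _ => coef (polytabloid F t)).
Proof.
apply: polytabloid_family => //.
- by move=> a r; apply: has_letter_above.
- by move=> a c; apply: has_letter_left.
- exact: coef_local.
- by move=> a b w; apply: coef_polytabloid_alt.
- by move=> w; apply: coef_polytabloid_supp.
Qed.

Lemma ev_ker u w (r s : nat) : (s < r)%N ->
  \sum_(z | w z == s) ev u (set_letter w z r) = 0.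
Proof.
move=> sr; rewrite /ev; have [a ->] := specht_sum (val_submodP u).
under eq_bigr => z _ do rewrite coef_sum.
rewrite exchange_big big1 //= => t _; rewrite -mulr_sumr.
by have /= -> := fam_ker (family_polytabloid t) w (leq0n (col_of t ord0)) sr; rewrite mulr0.
Qed.

Section Generator.

Variable t : tableau n.+1 la.

Definition gen : 'rV[F]_d := in_submod (specht_mx F n.+1 la) (polytabloid F t).

Lemma val_gen : val_submod gen = polytabloid F t.
Proof.
rewrite in_submodK //; apply: (sumsmx_sup t) => //.
by rewrite genmxE.
Qed.

Lemma ev_gen : ev gen = coef (polytabloid F t).
Proof. by rewrite /ev val_gen. Qed.

Lemma gen_alt a b : col_of t a = col_of t b -> a != b ->
  gen *m V (tperm a b) = - gen.
Proof.
move=> Cab ab; apply/eqP; rewrite -addr_eq0 -[_ *m _]scale1r; apply/eqP/ev_inj => w.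
by rewrite evZD ev_act ev_gen (coef_polytabloid_alt F w Cab ab) mul1r addNr.
Qed.

Lemma gen_garnir b c : (c < col_of t b)%N ->
  gen = \sum_(a | col_of t a == c) gen *m V (tperm a b).
Proof.
move=> cb; apply/eqP; rewrite -subr_eq0 addrC -scaleN1r; apply/eqP/ev_inj => w.
rewrite evZD ev_sum ev_gen.
rewrite (fam_garnir (family_polytabloid t) w (leq0n (col_of t b)) (leq0n c) cb).
rewrite mulN1r addrC; apply/eqP; rewrite subr_eq0; apply/eqP/eq_bigr => a _.
by rewrite ev_act ev_gen.
Qed.

Lemma ev_twist_swap X k a b w : fixes_max_comm V X ->
  ev (twist V X (tperm a b k) gen) (swap_word a b w)
  = ev (twist V X k (gen *m V (tperm a b))) w.
Proof.
by move=> cX; rewrite -[in RHS](tpermK a b k) twist_act // ev_act.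
Qed.

(** The alternating and Garnir relations of [gen] pass to its twists through [twist_act]; the kernel
    relation holds on the whole Specht module. *)
Lemma family_twist X : fixes_max_comm V X ->
  family (row_of t) (col_of t) 0 (fun k => ev (twist V X k gen)).
Proof.
move=> cX; split=> [k _|k w _|k w r s _|k a b w _ _ Cab ab|k b c w _ _ cb].
- exact: coef_local.
- exact: coef_content.
- exact: ev_ker.
- rewrite ev_twist_swap // gen_alt // /twist !mulNmx.
  by rewrite evN.
- rewrite [in LHS](gen_garnir cb) twist_sum ev_sum.
  by apply: eq_bigr => a _; rewrite ev_twist_swap.
Qed.

(** The tableaux form a single orbit, so [gen] generates the Specht module. *)
Lemma gen_generates (Z : 'M[F]_d) : (forall p, gen *m V p *m Z = 0) -> Z = 0.
Proof.
move=> gZ; rewrite -[Z]mul1mx -[1%:M](val_submodK (U := specht_mx F n.+1 la)).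
rewrite in_submodE -mulmxA; apply/sub_kermxP/(submx_trans (val_submodP _)).
apply/sumsmx_subP=> t' _; rewrite genmxE; apply/sub_kermxP.
have [p ->] := tab_transitive t t'.
rewrite -polytabloid_act -val_gen -(val_submodJ (specht_mxmodule F n.+1 la)) ?inE //.
by rewrite mulmxA -in_submodE val_submodK gZ.
Qed.


Lemma mx_span_of_jm_span x : jm_span (col_of t) 0 (coef (polytabloid F t)) x ->
  exists2 Y, mx_span (jm_mx V) Y & forall k w, x k w = ev (twist V Y k gen) w.
Proof.
elim=> [{}x x0|{}x y a b _ [Y SY yE] xE].
  exists 0; first by constructor.
  by move=> k w; rewrite x0 // /twist mulmx0 mul0mx ev0.
exists (a%:M + jm_mx V *m Y + b *: Y); first by constructor.
move=> k w; rewrite xE // !twistD twist_scalar twistZ twist_jm.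
rewrite [in RHS]addrC evZD addrC yE; congr (_ + _).
rewrite evZD ev_gen; congr (_ + _); rewrite ev_sum; apply: eq_bigr => j _.
rewrite yE -ev_twist_swap ?tpermR //; exact: mx_span_comm.
Qed.

Lemma specht_endo_span X : fixes_max_comm V X -> mx_span (jm_mx V) X.
Proof.
move=> cX.
have xS : jm_span (col_of t) 0 (coef (polytabloid F t)) (fun k => ev (twist V X k gen)).
  apply: (family_jm_span (R := row_of t)) => //.
  - exact: row_col_inj.
  - by move=> a r; apply: has_letter_above.
  - by move=> a c; apply: has_letter_left.
  - exact: family_polytabloid.
  - exact: coef_polytabloid1.
  - exact: family_twist.
have [Y SY XY] := mx_span_of_jm_span xS.
have cY := mx_span_comm SY; pose Z := X + (-1) *: Y.
have cZ : fixes_max_comm V Z.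
  by move=> p pmax; rewrite mulmxDl mulmxDr cX // -scalemxAl cY // scalemxAr.
have Z0 k : gen *m V (tperm k ord_max) *m Z = 0.
  have tw : twist V Z k gen = 0.
    by apply: ev_inj => w; rewrite twistD twistZ addrC evZD XY mulN1r addNr.
  have := congr1 (fun W => W *m V (tperm k ord_max)) tw.
  by rewrite mul0mx /twist -(mulmxA _ (V _) (V _)) -repr_permM tperm2 repr_mx1 mulmx1.
suff : Z = 0 by move/eqP; rewrite /Z scaleN1r subr_eq0 => /eqP->.
apply: gen_generates => p; pose k := (p^-1)%g ord_max.
(* Every [p] is (k ord_max) times an element of the stabiliser of [ord_max], with which [Z]
   commutes. *)
have -> : p = (tperm k ord_max * (tperm k ord_max * p))%g by rewrite mulgA tperm2 mul1g.
rewrite repr_permM mulmxA -[_ *m Z]mulmxA -cZ; first by rewrite mulmxA Z0 mul0mx.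
by rewrite permM tpermR permKV.
Qed.

(** The image of [gen] is alternating, hence a multiple of [gen] by [alternating_scalar]. *)
Lemma specht_endo_scalar X :
  (forall p, X *m V p = V p *m X) -> exists a, X = a%:M.
Proof.
move=> cX; have alt : alternating (row_of t) (col_of t) 0 (ev (gen *m X)).
  split=> [|w|a b w _ Cab ab]; first exact: coef_local.
    exact: coef_content.
  have <- : ev (gen *m X *m V (tperm a b)) w = - ev (gen *m X) w.
    by rewrite -mulmxA cX mulmxA gen_alt // mulNmx evN.
  by rewrite ev_act.
have genA : alternating (row_of t) (col_of t) 0 (coef (polytabloid F t)).
  apply: family_alternating (family_polytabloid t) (leq0n (col_of t ord0)) _.
  by [].
pose a := ev (gen *m X) (row_of t).
have E w : ev (gen *m X) w = a * coef (polytabloid F t) w.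
  exact: (alternating_scalar two_neq0 (@has_letter_left _ _ t) alt genA
    (coef_polytabloid1 F t)).
have gX : gen *m X = a *: gen.
  apply/eqP; rewrite -subr_eq0 addrC -scaleN1r scalerA mulN1r.
  by apply/eqP/ev_inj => w; rewrite evZD E ev_gen mulNr addNr.
exists a; apply/eqP; rewrite -subr_eq0; apply/eqP/gen_generates => p.
rewrite mulmxBr -[_ *m V p *m X]mulmxA -cX mulmxA gX -scalemxAl mul_mx_scalar.
exact: subrr.
Qed.

End Generator.

Lemma specht_endo_jm X : fixes_max_comm V X -> mx_span (jm_mx V) X.
Proof.
have [t _|none] := pickP [pred t : tableau n.+1 la | true].
  exact: specht_endo_span.
(* Without tableaux the sum [specht_mx] is empty and the module is zero. *)
move=> _; suff -> : X = 0 by constructor.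
have d0 : d = 0%N by rewrite /specht_mx big_pred0 ?mxrank0.
by apply/matrixP=> i; have := ltn_ord i; rewrite {2}d0.
Qed.

Lemma specht_endo_center X :
  (forall p, X *m V p = V p *m X) -> exists a, X = a%:M.
Proof.
have [t _|none] := pickP [pred t : tableau n.+1 la | true].
  exact: specht_endo_scalar.
move=> _; exists 0.
have d0 : d = 0%N by rewrite /specht_mx big_pred0 ?mxrank0.
by apply/matrixP=> i; have := ltn_ord i; rewrite {2}d0.
Qed.

End SpechtEndomorphisms.

(** * Restriction *)

Section SymIncl.

Variable n : nat.
Implicit Types (s : 'S_n) (p : 'S_n.+1).

Lemma sym_incl_max s : sym_incl n s ord_max = ord_max.
Proof. exact: lift_perm_id. Qed.

Lemma sym_incl_lift s i : sym_incl n s (lift ord_max i) = lift ord_max (s i).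
Proof. exact: lift_perm_lift. Qed.

Lemma sym_incl_inj : injective (sym_incl n).
Proof.
move=> s s' E; apply/permP=> i; apply: (@lift_inj _ ord_max).
by rewrite -!sym_incl_lift E.
Qed.

Lemma sym_inclM s s' : sym_incl n (s * s')%g = (sym_incl n s * sym_incl n s')%g.
Proof. by rewrite morphM ?inE. Qed.

Lemma sym_incl_tperm i j :
  sym_incl n (tperm i j) = tperm (lift ord_max i) (lift ord_max j).
Proof.
apply/permP=> k; case: (unliftP ord_max k) => [k' ->|->].
  rewrite sym_incl_lift; case: (tpermP i j k') => [->|->|ki kj].
  - by rewrite tpermL.
  - by rewrite tpermR.
  - by rewrite tpermD // (inj_eq lift_inj) eq_sym; apply/eqP.
by rewrite sym_incl_max tpermD // eq_sym neq_lift.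
Qed.

Lemma sym_incl_surj p : p ord_max = ord_max -> exists s, sym_incl n s = p.
Proof.
move=> pmax; have lift_p i : {j | p (lift ord_max i) = lift ord_max j}.
  case: (unliftP ord_max (p (lift ord_max i))) => [j ->|E]; first by exists j.
  by have /eqP := neq_lift ord_max i; case; apply: (@perm_inj _ p); rewrite E.
have inj : injective (fun i => sval (lift_p i)).
  move=> i j E; apply: (@lift_inj _ ord_max); apply: (@perm_inj _ p).
  by rewrite (svalP (lift_p i)) (svalP (lift_p j)) E.
exists (perm inj); apply/permP=> k; case: (unliftP ord_max k) => [k' ->|->].
  by rewrite sym_incl_lift permE; apply/esym/(svalP (lift_p k')).
by rewrite sym_incl_max pmax.
Qed.

Lemma sum_lift_max (A : zmodType) (f : 'I_n.+1 -> A) :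
  \sum_i f i = \sum_(i : 'I_n) f (lift ord_max i) + f ord_max.
Proof.
rewrite big_ord_recr /=; congr (_ + _); apply: eq_bigr => i _; congr f.
by apply: val_inj; rewrite [RHS]lift_max.
Qed.

Lemma sum_neq_max (A : zmodType) (f : 'I_n.+1 -> A) :
  \sum_(i | i != ord_max) f i = \sum_(i : 'I_n) f (lift ord_max i).
Proof.
apply: (addIr (f ord_max)); rewrite -sum_lift_max addrC.
by rewrite [RHS](bigD1 ord_max).
Qed.

End SymIncl.

(** * Endomorphisms given by central elements *)

Section CentralAction.

Variables (F : fieldType) (gT : finGroupType) (d : nat).
Variable rG : mx_representation F [set: gT] d.

Lemma central_action0 : central_action rG 0.
Proof. by exists 0; rewrite ?linear0 ?sub0mx. Qed.

Lemma central_actionD a A B :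
  central_action rG A -> central_action rG B -> central_action rG (a *: A + B).
Proof.
case=> [y Zy <-] [z Zz <-]; exists (a *: y + z); first exact: center_mxD.
by rewrite linearP.
Qed.

Lemma central_action_scalar a : central_action rG a%:M.
Proof.
rewrite -scalemx1 -[_ *: _]addr0; apply: central_actionD central_action0.
by exists 1%:M; [apply: center_mx1 | apply: gring_op1].
Qed.

Lemma central_actionM A B :
  central_action rG A -> central_action rG B -> central_action rG (A *m B).
Proof.
case=> [y Zy <-] [z Zz <-]; exists (y *m z); first exact: center_mxM.
by rewrite gring_opM //; have [] := center_mxP Zz.
Qed.

Lemma central_action_comm A g : central_action rG A -> A *m rG g = rG g *m A.
Proof.
case=> z /center_mxP[Rz Cz] <-.
rewrite -(gring_opG rG (in_setT g)) -!gring_opM ?envelop_mx_id ?inE //.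
by rewrite Cz // envelop_mx_id ?inE.
Qed.

Lemma central_actionC A B :
  central_action rG A -> central_action rG B -> A *m B = B *m A.
Proof.
case=> [y /center_mxP[Ry Cy] <-] [z /center_mxP[Rz Cz] <-].
by rewrite -!gring_opM // Cz.
Qed.

End CentralAction.

(** * The sum of all transpositions *)

Section TranspositionSum.

Variables (F : fieldType) (n : nat).

(** Ordered pairs with the diagonal included: twice the class sum of the transpositions plus [n]
    times the identity. *)
Definition tperm_sum d (V : mx_representation F [set: 'S_n] d) : 'M[F]_d :=
  \sum_i \sum_j V (tperm i j).

Lemma tperm_sum_comm d (V : mx_representation F [set: 'S_n] d) p :
  tperm_sum V *m V p = V p *m tperm_sum V.
Proof.
rewrite /tperm_sum mulmx_suml mulmx_sumr [RHS](reindex_inj (@perm_inj _ p)) /=.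
apply: eq_bigr => i _; rewrite mulmx_suml mulmx_sumr.
rewrite [RHS](reindex_inj (@perm_inj _ p)) /=; apply: eq_bigr => j _.
by rewrite -!repr_mxM ?inE // -tpermJ conjgE mulKVg.
Qed.

Lemma tperm_sum_central d (V : mx_representation F [set: 'S_n] d) :
  central_action V (tperm_sum V).
Proof.
exists (tperm_sum (regular_repr F [set: 'S_n])).
  apply/center_mxP; split.
    rewrite linear_sum summx_sub // => i _; rewrite linear_sum summx_sub // => j _.
    by rewrite envelop_mx_id ?inE.
  move=> B /envelop_mxP[a ->]; rewrite mulmx_suml mulmx_sumr.
  by apply: eq_bigr => p _; rewrite -scalemxAl -scalemxAr tperm_sum_comm.
rewrite linear_sum; apply: eq_bigr => i _; rewrite linear_sum.
by apply: eq_bigr => j _; rewrite /= gring_opG ?inE.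
Qed.

End TranspositionSum.

(** Each transposition moving [ord_max] comes from two ordered pairs, and the pair of [ord_max] with
    itself gives the identity. *)
Lemma tperm_sum_jm (F : fieldType) n d (V : mx_representation F [set: 'S_n.+1] d) :
  tperm_sum V = \sum_i \sum_j V (sym_incl n (tperm i j)) + 2%:R *: jm_mx V + 1%:M.
Proof.
rewrite /tperm_sum sum_lift_max sum_lift_max tperm1 repr_mx1.
under eq_bigr => i _ do rewrite sum_lift_max.
rewrite big_split /= /jm_mx sum_neq_max scaler_nat mulr2n !addrA.
congr (_ + _ + _ + _).
  by apply: eq_bigr => i _; apply: eq_bigr => j _; rewrite sym_incl_tperm.
by apply: eq_bigr => j _; rewrite tpermC.
Qed.

Section Restriction.

Variables (F : fieldType) (n : nat) (la : seq nat).
Hypothesis two_neq0 : 2%:R != 0 :> F.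
Hypothesis la_sorted : sorted geq la.

Lemma specht_restr_central A :
  (forall g, g \in [set: 'S_n] ->
     A *m restr_repr (sym_incl n) (specht_repr F n.+1 la) g
     = restr_repr (sym_incl n) (specht_repr F n.+1 la) g *m A) ->
  central_action (restr_repr (sym_incl n) (specht_repr F n.+1 la)) A.
Proof.
set V := specht_repr F n.+1 la; set W := restr_repr _ _ => cA.
have cmax : fixes_max_comm V A.
  by move=> p /sym_incl_surj[s <-]; have := cA s (in_setT s).
have [gamma Dgamma] := specht_endo_center two_neq0 la_sorted (tperm_sum_comm V).
(* This solves [tperm_sum_jm] for the Jucys-Murphy element, [gamma] being the scalar by which
   [tperm_sum V] acts. *)
have jmE : jm_mx V = (- 2%:R^-1) *: tperm_sum W + (2%:R^-1 * (gamma - 1))%:M.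
  apply: (scalerI two_neq0); rewrite scalerDr scalerA mulrN divff // scaleN1r.
  rewrite -scale_scalar_mx scalerA divff // scale1r raddfB /= -Dgamma tperm_sum_jm.
  by rewrite -/(tperm_sum W) addrK [RHS]addrC addrAC subrr add0r.
have jm_central : central_action W (jm_mx V).
  rewrite jmE; apply: central_actionD; first exact: tperm_sum_central.
  exact: central_action_scalar.
elim: (specht_endo_jm two_neq0 la_sorted cmax) => [|Y a b _ IH].
  exact: central_action0.
rewrite addrC; apply: central_actionD => //; rewrite -[_%:M]scale1r.
apply: central_actionD; first exact: central_action_scalar.
exact: central_actionM.
Qed.

End Restriction.

(** * Induction *)

Section Induced.

Variables (F : fieldType) (n d : nat).
Variable V : mx_representation F [set: 'S_n.+1] d.

Local Notation G := [set: 'S_n.+2]%G.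
Local Notation f := (sym_incl n.+1).
Local Notation B := (balance_mx f V).
Local Notation Q := (ind_repr f V).
Local Notation dQ := (\rank (cokermx B)).
Local Notation M := (@ord_max n.+1).
Local Notation r z := (tperm z M).
Implicit Types (g : 'S_n.+2) (h : 'S_n.+1) (z : 'I_n.+2).

(** The inverse of the inclusion on the permutations fixing [M]; the value 1 elsewhere is a
    default. *)
Definition retract g : 'S_n.+1 := odflt 1%g [pick h | f h == g].

Lemma retractK h : retract (f h) = h.
Proof.
rewrite /retract; case: pickP => [h' /eqP /sym_incl_inj-> //|/(_ h)].
by rewrite eqxx.
Qed.

Lemma retract1 : retract 1 = 1%g.
Proof. by rewrite -(morph1 f) retractK. Qed.

Lemma sym_incl_retract g : g M = M -> f (retract g) = g.
Proof. by case/sym_incl_surj=> h <-; rewrite retractK. Qed.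

Lemma tens_sum (a : 'I_d -> F) (u : 'I_d -> 'rV[F]_d) (x : 'rV[F]_#|G|) :
  tens (\sum_i a i *: u i) x = \sum_i a i *: tens (u i) x.
Proof.
rewrite /tens linear_sum mulmx_suml linear_sum; apply: eq_bigr => i _.
by rewrite linearZ /= -scalemxAl linearZ.
Qed.

Definition extract g : 'M[F]_(d * #|G|, d) :=
  \matrix_(k, i) (k == mxvec_index i (gring_index G g))%:R.

Lemma tens_extract (v : 'rV[F]_d) x g : tens v x *m extract g = x 0 (gring_index G g) *: v.
Proof.
apply/rowP=> i; rewrite !mxE (bigD1 (mxvec_index i (gring_index G g))) //=.
rewrite big1 => [|k /negPf ki]; last by rewrite [X in _ * X]mxE ki mulr0.
by rewrite [X in _ * X]mxE eqxx mulr1 addr0 /tens mxvecE mxE big_ord1 mxE mulrC.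
Qed.

Lemma gbasis_coef g g' : gbasis F g 0 (gring_index G g') = (g' == g)%:R.
Proof.
by rewrite mxE eqxx (inj_in_eq (can_in_inj (@gring_indexK _ G))) ?inE.
Qed.

(** The [g] with [g M = z] form the coset of [r z]. With [h = retract (g * r z)] one has
    [g = f h * r z], so v (x) g equals v h (x) r z in the induced module. *)
Definition coset_proj z : 'M[F]_(d * #|G|, d) :=
  \sum_(g : 'S_n.+2 | g M == z) extract g *m V (retract (g * r z)).

Lemma tens_coset_proj (v : 'rV[F]_d) g z : tens v (gbasis F g) *m coset_proj z
  = (g M == z)%:R *: (v *m V (retract (g * r z))).
Proof.
rewrite mulmx_sumr; case: eqP => [gz|gz]; last first.
  rewrite scale0r big1 // => g' /eqP gz'; rewrite mulmxA tens_extract gbasis_coef.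
  by case: eqP => [E|]; [rewrite -E gz' in gz | rewrite scale0r mul0mx].
rewrite (bigD1 g) /= ?gz // mulmxA tens_extract gbasis_coef eqxx.
rewrite big1 => [|g' /andP[_ /negPf g'g]].
  by rewrite addr0 -scalemxAl.
by rewrite mulmxA tens_extract gbasis_coef g'g scale0r mul0mx.
Qed.

Lemma balance_coset_proj z : B *m coset_proj z = 0.
Proof.
apply/sub_kermxP/sumsmx_subP=> i _; apply/sumsmx_subP=> h _.
apply/sumsmx_subP=> g _; rewrite genmxE; apply/sub_kermxP.
rewrite mulmxBl !tens_coset_proj permM sym_incl_max.
have [gz|_] := eqVneq (g M) z; last by rewrite !scale0r subrr.
have -> : retract (f h * g * r z) = (h * retract (g * r z))%g.
  rewrite -mulgA -[(g * r z)%g in LHS]sym_incl_retract -?sym_inclM ?retractK //.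
  by rewrite permM gz tpermL.
by rewrite repr_permM mulmxA subrr.
Qed.

Definition unit_mx : 'M[F]_(d, dQ) :=
  in_factmod B (\matrix_i tens (delta_mx 0 i) (gbasis F 1%g)).

Lemma tens_unit (v : 'rV[F]_d) : v *m unit_mx = in_factmod B (tens v (gbasis F 1%g)).
Proof.
rewrite /unit_mx in_factmodE mulmxA [in RHS]in_factmodE; congr (_ *m _).
rewrite mulmx_sum_row [in RHS](row_sum_delta v) tens_sum.
by apply: eq_bigr => i _; rewrite rowK.
Qed.

Lemma tens_unit_act (v : 'rV[F]_d) g : v *m unit_mx *m Q g = in_factmod B (tens v (gbasis F g)).
Proof.
rewrite tens_unit -(in_factmodJ (balance_mxmodule f V)) ?inE //.
by rewrite tens_mxE gbasisM mul1g.
Qed.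

Definition coord z : 'M[F]_(dQ, d) := val_factmod (U := B) 1%:M *m coset_proj z.

Lemma in_factmod_coord m (W : 'M_(m, d * #|G|)) z :
  in_factmod B W *m coord z = W *m coset_proj z.
Proof.
rewrite /coord mulmxA -val_factmodE; apply/eqP; rewrite -subr_eq0 -mulmxBl.
have : (val_factmod (in_factmod B W) - W <= B)%MS.
  by rewrite -in_factmod_eq0 linearB /= val_factmodK subrr.
by case/submxP=> D ->; rewrite -mulmxA balance_coset_proj mulmx0.
Qed.

Lemma unit_coord g z :
  unit_mx *m Q g *m coord z = (g M == z)%:R *: V (retract (g * r z)).
Proof.
apply/row_matrixP=> i; rewrite !rowE (mulmxA _ (unit_mx *m _)) (mulmxA _ unit_mx).
rewrite tens_unit_act in_factmod_coord.
by rewrite tens_coset_proj scalemxAr.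
Qed.

Lemma unit_act h : V h *m unit_mx = unit_mx *m Q (f h).
Proof.
apply/row_matrixP=> i; rewrite !rowE (mulmxA _ (V h)) (mulmxA _ unit_mx).
rewrite tens_unit_act tens_unit.
apply/eqP; rewrite -subr_eq0 -linearB /= in_factmod_eq0.
apply: (sumsmx_sup i) => //; apply: (sumsmx_sup h) => //.
by apply: (sumsmx_sup 1%g) => //; rewrite genmxE /balance mulg1.
Qed.

(** A tensor v (x) g has a nonzero coordinate at most at [z = g M], and there the summand rebuilds
    it as v h (x) r z. *)
Lemma coord_sum : \sum_z coord z *m unit_mx *m Q (r z) = 1%:M.
Proof.
set S := LHS.
suff inS : in_factmod B 1%:M *m S = in_factmod B 1%:M.
  rewrite -[LHS]mul1mx -(val_factmodK (1%:M : 'M_dQ)).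
  by rewrite in_factmodE -mulmxA inS.
apply/row_matrixP=> k; rewrite !rowE mulmxA -in_factmodE.
case/mxvec_indexP: k => i j; rewrite -mxvec_delta.
have -> : mxvec (delta_mx i j) = tens (delta_mx 0 i) (gbasis F (enum_val j)) :> 'rV[F]_(d * #|G|).
  by rewrite /tens /gbasis gring_valK trmx_delta mul_delta_mx.
move: (enum_val j) => g {j}; rewrite -tens_unit_act /S mulmx_sumr.
have term z : delta_mx 0 i *m unit_mx *m Q g *m (coord z *m unit_mx *m Q (r z))
    = (g M == z)%:R *: (delta_mx 0 i *m unit_mx *m Q g).
  rewrite (mulmxA _ (coord z *m _)) (mulmxA _ (coord z)).
  rewrite -(mulmxA _ unit_mx (Q g)) -(mulmxA _ (unit_mx *m Q g) (coord z)) unit_coord.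
  have [gz|_] := eqVneq (g M) z; last by rewrite !scale0r mulmx0 !mul0mx.
  rewrite !scale1r -(mulmxA _ (V _)) unit_act -!(mulmxA (delta_mx _ _)).
  rewrite -(mulmxA unit_mx) -repr_permM sym_incl_retract; last by rewrite permM gz tpermL.
  by rewrite -mulgA tperm2 mulg1.
under eq_bigr => z _ do rewrite term.
rewrite (bigD1 (g M)) //= eqxx scale1r big1 ?addr0 // => z zg.
by rewrite eq_sym (negPf zg) scale0r.
Qed.

End Induced.

(** * Mackey components of an endomorphism of the induced module *)

Section InducedEndomorphisms.

Variables (F : fieldType) (n d D : nat).
Variable V : mx_representation F [set: 'S_n.+1] d.
Variable Q : mx_representation F [set: 'S_n.+2] D.

Local Notation f := (sym_incl n.+1).
Local Notation M := (@ord_max n.+1).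
Local Notation r z := (tperm z M).
Local Notation m := (lift M (@ord_max n)).
Implicit Types (g : 'S_n.+2) (h : 'S_n.+1) (z : 'I_n.+2).

(* Q = V (x)_{FH} FG = (+)_z V (x) r z: iota is v |-> v (x) 1, and c z is the
   component at the coset of r z. *)
Variables (iota : 'M[F]_(d, D)) (c : 'I_n.+2 -> 'M[F]_(D, d)).
Hypothesis iota_c : forall g z,
  iota *m Q g *m c z = (g M == z)%:R *: V (retract (g * r z)).
Hypothesis iota_act : forall h, V h *m iota = iota *m Q (f h).
Hypothesis c_sum : \sum_z c z *m iota *m Q (r z) = 1%:M.

Definition component A z := iota *m A *m c z.

Lemma act_c g z :
  Q g *m c z
  = c ((g^-1)%g z) *m V (retract (r ((g^-1)%g z) * g * r z)).
Proof.
rewrite -[LHS]mul1mx -c_sum mulmx_suml (bigD1 ((g^-1)%g z)) //=.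
have E y : c y *m iota *m Q (r y) *m (Q g *m c z)
    = c y *m ((g y == z)%:R *: V (retract (r y * g * r z))).
  rewrite mulmxA -(mulmxA _ (Q (r y))) -repr_permM -2!(mulmxA (c y)) iota_c.
  by rewrite permM tpermR.
rewrite big1 => [|y yz]; first by rewrite E permKV eqxx scale1r addr0.
rewrite E -(inj_eq (@perm_inj _ (g^-1)%g)) permK (negPf yz) scale0r.
exact: mulmx0.
Qed.

Variable A : 'M[F]_D.
Hypothesis A_comm : forall g, A *m Q g = Q g *m A.

Lemma component_act h z :
  V h *m component A z
  = component A ((f h)^-1%g z)
    *m V (retract (r ((f h)^-1%g z) * f h * r z)).
Proof.
rewrite /component !(mulmxA (V h)) iota_act -(mulmxA iota (Q _)) -A_comm.
by rewrite (mulmxA iota) -(mulmxA _ (Q _)) act_c !mulmxA.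
Qed.

(** The subgroup fixes the coset labelled [M]; this component is the entry s of the pair (s,
    theta). *)
Lemma component_max_comm h : component A M *m V h = V h *m component A M.
Proof.
rewrite component_act; have -> : ((f h)^-1)%g M = M.
  by rewrite -{1}(sym_incl_max h) permK.
by rewrite tperm1 mul1g mulg1 retractK.
Qed.

(** The stabiliser of [ord_max] in the subgroup fixes the coset labelled [m]; this component is the
    entry theta. *)
Lemma component_jm_comm : fixes_max_comm V (component A m).
Proof.
move=> h hmax; have fm : f h m = m by rewrite sym_incl_lift hmax.
rewrite component_act; have -> : ((f h)^-1)%g m = m by rewrite -{1}fm permK.
have -> : (r m * f h * r m = f h)%g; last by rewrite retractK.
rewrite -[(r m * f h)%g](mulKVg (f h)) -conjgE tpermJ fm sym_incl_max.
by rewrite -mulgA tperm2 mulg1.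
Qed.

(** The subgroup is transitive on the letters other than [M], so two components determine all, and
    the image of V (x) 1 determines [A]. *)
Lemma component_eq0 : component A M = 0 -> component A m = 0 -> A = 0.
Proof.
move=> cM cm; have c0 z : component A z = 0.
  case: (unliftP M z) => [k ->|-> //].
  have := component_act (tperm k ord_max) (lift M k).
  rewrite sym_incl_tperm tpermV tpermL cm mul0mx => /(congr1 (mulmx (V (tperm k ord_max)))).
  by rewrite mulmxA -repr_permM tperm2 repr_mx1 mul1mx mulmx0.
have iA : iota *m A = 0.
  rewrite -[LHS]mulmx1 -c_sum mulmx_sumr big1 // => z _.
  by rewrite (mulmxA _ (c z *m _)) (mulmxA _ (c z)) -/(component A z) c0 !mul0mx.
rewrite -[LHS]mul1mx -c_sum mulmx_suml big1 // => z _.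
by rewrite -mulmxA -A_comm mulmxA -(mulmxA (c z)) iA mulmx0 mul0mx.
Qed.

Variable tau : 'M[F]_D.
Hypothesis A_tau : A *m tau = tau *m A.
Hypothesis iota_tau : iota *m tau = iota *m jm_mx Q.

(** In [jm_mx Q] the transposition (m M) exchanges the cosets [M] and [m] and gives the first term;
    the others, conjugated by (m M), become the terms of [jm_mx V]. *)
Lemma component_tau :
  component (A *m tau) m = component A M + component A m *m jm_mx V.
Proof.
rewrite /component A_tau (mulmxA iota) iota_tau /jm_mx sum_neq_max.
rewrite mulmx_sumr !mulmx_suml (bigD1 ord_max) //=; congr (_ + _).
  rewrite -(mulmxA iota) -A_comm (mulmxA iota) -mulmxA act_c tpermV tpermL.
  by rewrite tperm1 mul1g tperm2 retract1 repr_mx1 mulmx1.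
rewrite mulmx_sumr; apply: eq_bigr => k kmax.
rewrite -(mulmxA iota) -A_comm (mulmxA iota) -mulmxA act_c tpermV.
rewrite (tpermD (z := m)) ?neq_lift //; last by rewrite (inj_eq lift_inj).
have -> : (r m * r (lift M k) * r m)%g = f (tperm k ord_max).
  by rewrite sym_incl_tperm -{1}[r m]tpermV -mulgA -conjgE tpermJ tpermR
             tpermD ?neq_lift // (inj_eq lift_inj) eq_sym.
by rewrite retractK mulmxA.
Qed.

End InducedEndomorphisms.

Lemma mx_spanC (F : fieldType) d (L Y : 'M[F]_d) : mx_span L Y -> Y *m L = L *m Y.
Proof.
elim=> [|{}Y a b _ IH]; first by rewrite mul0mx mulmx0.
by rewrite !mulmxDl !mulmxDr -scalemxAl -scalemxAr IH -mulmxA IH scalar_mxC.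
Qed.

(** * Centrality of the endomorphisms of the induced module *)

Section InducedCentral.

Variables (F : fieldType) (n d D : nat).
Variable V : mx_representation F [set: 'S_n.+1] d.
Variable Q : mx_representation F [set: 'S_n.+2] D.
Hypothesis two_neq0 : 2%:R != 0 :> F.
Hypothesis V_scalar :
  forall X, (forall p, X *m V p = V p *m X) -> exists a, X = a%:M.
Hypothesis V_jm : forall X, fixes_max_comm V X -> mx_span (jm_mx V) X.

Local Notation f := (sym_incl n.+1).
Local Notation M := (@ord_max n.+1).
Local Notation r z := (tperm z M).
Local Notation m := (lift M (@ord_max n)).

Variables (iota : 'M[F]_(d, D)) (c : 'I_n.+2 -> 'M[F]_(D, d)).
Hypothesis iota_c : forall g z,
  iota *m Q g *m c z = (g M == z)%:R *: V (retract (g * r z)).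
Hypothesis iota_act : forall h, V h *m iota = iota *m Q (f h).
Hypothesis c_sum : \sum_z c z *m iota *m Q (r z) = 1%:M.

(** On V (x) 1 the central [tperm_sum Q] acts as [gamma + 1] plus twice the Jucys-Murphy element,
    where [gamma] is the scalar of [tperm_sum V]. *)
Lemma exists_tau :
  exists2 tau, central_action Q tau & iota *m tau = iota *m jm_mx Q.
Proof.
have [gamma Dgamma] := V_scalar (tperm_sum_comm V).
exists (2%:R^-1 *: tperm_sum Q + (- (2%:R^-1 * (gamma + 1)))%:M).
  apply: central_actionD; first exact: tperm_sum_central.
  exact: central_action_scalar.
have E : iota *m (\sum_i \sum_j Q (f (tperm i j))) = gamma *: iota.
  rewrite -mul_scalar_mx -Dgamma /tperm_sum mulmx_sumr mulmx_suml.
  apply: eq_bigr => i _; rewrite mulmx_sumr mulmx_suml.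
  by apply: eq_bigr => j _; rewrite iota_act.
have E' : iota *m tperm_sum Q = (gamma + 1) *: iota + 2%:R *: (iota *m jm_mx Q).
  rewrite tperm_sum_jm !mulmxDr E mulmx1 -scalemxAr [(gamma + 1) *: _]scalerDl scale1r.
  by rewrite addrAC.
rewrite mulmxDr -scalemxAr E' mul_mx_scalar scaleNr scalerDr !scalerA mulVf //.
by rewrite scale1r addrAC subrr add0r.
Qed.

Lemma component_scalar a : component iota c a%:M M = a%:M /\ component iota c a%:M m = 0.
Proof.
have E z : component iota c a%:M z = a *: ((M == z)%:R *: V (retract (r z))).
  rewrite /component mul_mx_scalar -scalemxAl.
  by have := iota_c 1 z; rewrite repr_mx1 mulmx1 perm1 mul1g => ->.
rewrite !E eqxx tperm1 retract1 repr_mx1 scale1r scalemx1.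
by rewrite (negPf (neq_lift _ _)) scale0r scaler0.
Qed.

Lemma componentP a A B z : component iota c (a *: A + B) z
  = a *: component iota c A z + component iota c B z.
Proof. by rewrite /component mulmxDr mulmxDl -scalemxAr -scalemxAl. Qed.

Lemma induced_endo_central A :
  (forall g, A *m Q g = Q g *m A) -> central_action Q A.
Proof.
move=> cA; have [tau tauC iota_tau] := exists_tau.
have lift_span Y : mx_span (jm_mx V) Y ->
    exists2 B, central_action Q B & component iota c B m = Y.
  elim=> [|{}Y a b SY [B BC BY]].
    by exists 0; [apply: central_action0 | rewrite /component mulmx0 mul0mx].
  have cB g := central_action_comm g BC.
  have Btau := central_actionC BC tauC.
  have [s sE] := V_scalar (component_max_comm iota_c iota_act c_sum cB).
  (* At [m] the component of [B *m tau] is [s + Y L] with [L = jm_mx V], and that of [tau] is 1; the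
     multiple [a - s] of [tau] corrects the constant to [a]. *)
  exists (1 *: (B *m tau) + (b *: B + ((a - s) *: tau + 0))).
    do !apply: central_actionD => //; [exact: central_actionM | exact: central_action0].
  have tau1 : component iota c tau m = 1%:M.
    have [c1 c1'] := component_scalar 1.
    have := component_tau iota_c c_sum (A := 1%:M) _ (tau := tau) _ iota_tau.
    rewrite !mul1mx mulmx1 c1 c1' mul0mx addr0; apply=> // g.
    by rewrite mul1mx mulmx1.
  rewrite !componentP (component_tau iota_c c_sum cB Btau iota_tau) BY sE tau1.
  rewrite (_ : component iota c 0 m = 0); last by rewrite /component mulmx0 mul0mx.
  rewrite scale1r addr0 scalemx1 mx_spanC // raddfB /=.
  by rewrite [b *: Y + _]addrC addrA; congr (_ + _); rewrite addrC addrA subrK.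
(* [B] is central with the same component at [m] as [A], so the difference has components (s, 0), as
   has the scalar [s]. *)
have [B BC BY] := lift_span _ (V_jm (component_jm_comm iota_c iota_act c_sum cA)).
have cB g := central_action_comm g BC.
have cAB g : ((-1) *: B + A) *m Q g = Q g *m ((-1) *: B + A).
  by rewrite mulmxDl mulmxDr -scalemxAl -scalemxAr cA cB.
have [s sE] := V_scalar (component_max_comm iota_c iota_act c_sum cAB).
pose Z := (-1) *: s%:M + ((-1) *: B + A).
have cZ g : Z *m Q g = Q g *m Z.
  by rewrite mulmxDl mulmxDr -scalemxAl -scalemxAr cAB scalar_mxC.
have [s1 s0] := component_scalar s.
have : Z = 0.
  apply: (component_eq0 iota_c iota_act c_sum cZ).
    by rewrite /Z componentP sE s1 scaleN1r addNr.
  by rewrite /Z componentP s0 componentP BY scaler0 add0r scaleN1r addNr.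
rewrite /Z !scaleN1r => /eqP; rewrite addrC subr_eq0 addrC subr_eq => /eqP ->.
by rewrite -[s%:M]scale1r; apply: central_actionD => //; apply: central_action_scalar.
Qed.

End InducedCentral.

Theorem theorem3p4 (n : nat) (F : fieldType) (la : seq nat)
    (charF : (2%N \notin [pchar F])%R) (la_part : is_partition n.+1 la) :
  (forall b : 'M[F]_#|[set: 'S_n]|,
     block_idempotent (G := [set: 'S_n]%G) b ->
     let V := restr_repr (sym_incl n) (specht_repr F n.+1 la) in
     mod_mul V b = 0%R \/ mxindecomposable V (mod_mul V b))
  /\
  (forall B : 'M[F]_#|[set: 'S_n.+2]|,
     block_idempotent (G := [set: 'S_n.+2]%G) B ->
     let V := ind_repr (sym_incl n.+1) (specht_repr F n.+1 la) in
     mod_mul V B = 0%R \/ mxindecomposable V (mod_mul V B)).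
Proof.
have two_neq0 : 2%:R != 0 :> F by move: charF; rewrite inE.
have la_sorted : sorted geq la by case/and3P: la_part.
split=> b block_b V; apply: block_indecomposable block_b _ => A cA.
  exact: (specht_restr_central two_neq0 la_sorted).
have V_scalar := specht_endo_center (n := n) two_neq0 la_sorted.
have V_jm := specht_endo_jm (n := n) two_neq0 la_sorted.
apply: (induced_endo_central two_neq0 V_scalar V_jm
  (unit_coord _) (unit_act _) (coord_sum _)) => g.
by apply: cA; rewrite inE.
Qed.
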